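(* Let $T=(T^1,\dots,T^p)$ with all $T^i>0$ and $T_0=[0,T^1]\times\dots\times[0,T^p]\subset\mathbb{R}^p$. Let $L:T_0\times\mathbb{R}^n\times\mathbb{R}^{np}\to\mathbb{R}$, $(t,x,y)\mapsto L(t,x,y)$, be measurable in $t$ for every $(x,y)\in\mathbb{R}^n\times\mathbb{R}^{np}$ and with continuous partial derivatives in $x$ and $y$ for every $t\in T_0$. Suppose there exist $a\in C^1(\mathbb{R}^+,\mathbb{R}^+)$ with derivative $a'$ bounded from above and $b\in C(T_0,\mathbb{R}^+)$ such that for all $t\in T_0$ and all $(x,y)\in\mathbb{R}^n\times\mathbb{R}^{np}$, $$|L(t,x,y)|\le a(|x|+|y|^2)\,b(t),\qquad |\nabla_xL(t,x,y)|\le a(|x|)\,b(t),\qquad |\nabla_yL(t,x,y)|\le a(|y|)\,b(t).$$ Then the functional $$\varphi:W_T^{1,2}\to\mathbb{R},\qquad \varphi(u)=\int_{T_0}L\Big(t,u(t),\frac{\partial u}{\partial t}(t)\Big)dt,$$ is continuously differentiable on $W_T^{1,2}$, and its gradient (derivative) is given, for $u,v\in W_T^{1,2}$, by $$(\nabla\varphi(u),v)=\int_{T_0}\left[\Big(\nabla_xL\Big(t,u(t),\frac{\partial u}{\partial t}(t)\Big),v(t)\Big)+\Big(\nabla_yL\Big(t,u(t),\frac{\partial u}{\partial t}(t)\Big),\frac{\partial v}{\partial t}(t)\Big)\right]dt.$$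
   Context: Here $dt=dt^1\wedge\dots\wedge dt^p$ denotes Lebesgue measure on $T_0$, $\mathbb{R}^+=[0,\infty)$, and $|\cdot|$, $(\cdot,\cdot)$ are the Euclidean norm and scalar product. $C_T^\infty$ is the space of infinitely differentiable functions $\mathbb{R}^p\to\mathbb{R}^n$ that are periodic with period $T^\alpha$ in the variable $t^\alpha$ for each $\alpha=1,\dots,p$. $W_T^{1,2}$ is the Hilbert space of functions $u\in L^2(T_0,\mathbb{R}^n)$ having weak derivatives $\partial u/\partial t=(\partial u^i/\partial t^\alpha)_{i,\alpha}$ in $L^2$, where weak derivatives are defined by testing against functions in $C_T^\infty$: $\int_{T_0}(u,\partial f/\partial t^\alpha)\,dt=-\int_{T_0}(\partial u/\partial t^\alpha,f)\,dt$ for all $f\in C_T^\infty$. Its scalar product is $\langle u,v\rangle=\int_{T_0}\big(\sum_iu^iv^i+\sum_{i,\alpha}\frac{\partial u^i}{\partial t^\alpha}\frac{\partial v^i}{\partial t^\alpha}\big)dt$. On the left-hand side of the gradient formula, $(\nabla\varphi(u),v)$ is the value at $v$ of the derivative $\varphi'(u)\in(W_T^{1,2})^*$; continuously differentiable means $u\mapsto\varphi'(u)$ is continuous from $W_T^{1,2}$ to $(W_T^{1,2})^*$. *)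

(* Defs.v *)
From HB Require Import structures.
From mathcomp Require Import all_boot all_order all_algebra.
From mathcomp Require Import all_classical all_reals all_analysis.
From mathcomp Require Import measurable_realfun lra ring.

Set Implicit Arguments.
Unset Strict Implicit.
Unset Printing Implicit Defensive.

Import Order.TTheory GRing.Theory Num.Theory.
Import numFieldNormedType.Exports.

Local Open Scope classical_set_scope.
Local Open Scope ring_scope.
Local Open Scope quotient_scope.

Definition rV_display : measure_display. Proof. exact: default_measure_display. Qed.

Section rV_measurable.
Variables (R : realType) (p : nat).

Definition rV_coord (i : 'I_p) (t : 'rV[R]_p) : R := t 0 i.

(* The product sigma-algebra, i.e. the Borel sets of R^p. *)
Let rV_set0 : g_sigma_preimage rV_coord set0.
Proof. exact: sigma_algebra0. Qed.

Let rV_setC A : g_sigma_preimage rV_coord A -> g_sigma_preimage rV_coord (~` A).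
Proof. exact: sigma_algebraC. Qed.

Let rV_bigcup (F : _^nat) : (forall i, g_sigma_preimage rV_coord (F i)) ->
  g_sigma_preimage rV_coord (\bigcup_i (F i)).
Proof. exact: sigma_algebra_bigcup. Qed.

HB.instance Definition _ := @isMeasurable.Build rV_display
  'rV[R]_p (g_sigma_preimage rV_coord) rV_set0 rV_setC rV_bigcup.

Lemma measurable_coord (i : 'I_p) :
  measurable_fun [set: 'rV[R]_p] (fun t => t 0 i).
Proof.
move=> _ Y mY; rewrite setTI; apply: sub_sigma_algebra => /=.
rewrite -bigcup_seq/=; exists i => /=; first by rewrite mem_index_enum.
by exists Y => //; rewrite setTI.
Qed.

Lemma measurable_fun_coordP d (T : measurableType d) (f : T -> 'rV[R]_p) :
  (forall i, measurable_fun setT (fun x => f x 0 i)) -> measurable_fun setT f.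
Proof.
move=> mf _ A mA; rewrite setTI.
pose G := [set B : set 'rV[R]_p | measurable (f @^-1` B)].
suff : g_sigma_preimage rV_coord `<=` G by exact.
apply: smallest_sub.
  split=> /=.
  - by rewrite /G/= preimage_set0.
  - by move=> B GB; rewrite /G/= setTD preimage_setC; exact: measurableC.
  - by move=> F GF; rewrite /G/= preimage_bigcup; exact: bigcupT_measurable.
rewrite -bigcup_seq/= => B [i _ [Y mY <-]].
by rewrite /G/= -[X in measurable X]setTI setTI; apply: (mf i).
Qed.

End rV_measurable.

Lemma sigma_finite_prod d1 d2 (T1 : measurableType d1) (T2 : measurableType d2)
    (R : realType) (m1 : {sigma_finite_measure set T1 -> \bar R})
    (m2 : {sigma_finite_measure set T2 -> \bar R}) :
  sigma_finite setT (m1 \x m2)%E.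
Proof.
have /sigma_finiteP[F [TF ndF Foo]] := sigma_finiteT m1.
have /sigma_finiteP[G [TG ndG Goo]] := sigma_finiteT m2.
exists (fun n => F n `*` G n).
  rewrite -setXTT TF TG predeqE => -[x y]; split; last first.
    by move=> [n _ []/= ? ?]; split; exists n.
  move=> [/= [n _ Fnx] [k _ Gky]]; exists (maxn n k) => //; split.
  - by move: x Fnx; exact/subsetPset/ndF/leq_maxl.
  - by move: y Gky; exact/subsetPset/ndG/leq_maxr.
move=> k; have [? ?] := Foo k; have [? ?] := Goo k.
split; first exact: measurableX.
by rewrite product_measure1E// lte_mul_pinfty// ge0_fin_numE.
Qed.

Section cons_rV.
Variables (R : realType) (p : nat).

Definition cons_rV (z : R * 'rV[R]_p) : 'rV[R]_p.+1 := 
  \row_i oapp (z.2 0) z.1 (unlift ord0 i).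

Definition uncons_rV (t : 'rV[R]_p.+1) : R * 'rV[R]_p :=
  (t 0 ord0, \row_i t 0 (lift ord0 i)).

Lemma cons_rV0 z : cons_rV z 0 ord0 = z.1.
Proof.
by rewrite mxE unlift_none.
Qed.

Lemma cons_rVS z i : cons_rV z 0 (lift ord0 i) = z.2 0 i.
Proof.
by rewrite mxE liftK.
Qed.

Lemma cons_rVK : cancel cons_rV uncons_rV.
Proof.
case=> x v; rewrite /uncons_rV cons_rV0/=; congr pair.
by apply/rowP => i; rewrite mxE cons_rVS.
Qed.

Lemma uncons_rVK : cancel uncons_rV cons_rV.
Proof.
move=> t; apply/rowP => i; case: (unliftP ord0 i) => [j|] ->.
  by rewrite cons_rVS mxE.
by rewrite cons_rV0.
Qed.

Lemma measurable_cons_rV : measurable_fun setT cons_rV.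
Proof.
apply: measurable_fun_coordP => i; case: (unliftP ord0 i) => [j|] ->.
  under eq_fun do rewrite cons_rVS.
  exact: (measurableT_comp (measurable_coord j) measurable_snd).
under eq_fun do rewrite cons_rV0.
exact: measurable_fst.
Qed.

Lemma measurable_uncons_rV : measurable_fun setT uncons_rV.
Proof.
apply: measurable_fun_pair => /=; first exact: measurable_coord.
apply: measurable_fun_coordP => i; under eq_fun do rewrite mxE.
exact: measurable_coord.
Qed.

Variable m : {sigma_finite_measure set 'rV[R]_p -> \bar R}.

Definition cons_measure : set 'rV[R]_p.+1 -> \bar R :=
  pushforward (lebesgue_measure \x m)%E cons_rV.

Let cons_measure0 : cons_measure set0 = 0%E.
Proof. by rewrite /cons_measure /pushforward preimage_set0 measure0. Qed.

Let cons_measure_ge0 A : (0 <= cons_measure A)%E.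
Proof. by rewrite /cons_measure /pushforward measure_ge0. Qed.

Let cons_measure_sigma : semi_sigma_additive cons_measure.
Proof.
move=> F mF tF mUF; rewrite /cons_measure /pushforward preimage_bigcup.
apply: measure_semi_sigma_additive.
- by move=> n; rewrite -[X in measurable X]setTI; exact: measurable_cons_rV.
- apply/trivIsetP => /= i j _ _ ij; rewrite -preimage_setI.
  by move/trivIsetP : tF => /(_ _ _ _ _ ij) ->//; rewrite preimage_set0.
- rewrite -preimage_bigcup -[X in measurable X]setTI.
  exact: measurable_cons_rV.
Qed.

HB.instance Definition _ := isMeasure.Build _ _ _ cons_measure
  cons_measure0 cons_measure_ge0 cons_measure_sigma.

Let cons_measure_sigma_finite : sigma_finite setT cons_measure.
Proof.
have [F TF Foo] : sigma_finite setT (lebesgue_measure \x m)%E.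
  exact: sigma_finite_prod.
exists (fun n => uncons_rV @^-1` F n).
  by rewrite -preimage_bigcup -TF preimage_setT.
move=> n; have [mF muF] := Foo n; split.
  by rewrite -[X in measurable X]setTI; exact: measurable_uncons_rV.
rewrite /cons_measure /pushforward -comp_preimage.
by rewrite (_ : uncons_rV \o cons_rV = id)//; apply/funext => z; exact: cons_rVK.
Qed.

HB.instance Definition _ := Measure_isSigmaFinite.Build _ _ _ cons_measure
  cons_measure_sigma_finite.

End cons_rV.

(* The p-fold product of the one-dimensional Lebesgue measure, on Borel sets. *)
Fixpoint borel_lebesgue (R : realType) (p : nat) :
    {sigma_finite_measure set 'rV[R]_p -> \bar R} :=
  match p with
  | 0 => \d_(0 : 'rV[R]_0)
  | p.+1 => cons_measure (borel_lebesgue R p)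
  end.


(* R^p with the sigma-algebra of Lebesgue measurable sets: the Caratheodory
   measurable sets of the outer measure induced by borel_lebesgue. The type
   unfolds to 'rV[R]_p, which carries the smaller Borel sigma-algebra. *)
Definition lebesgue_rV (R : realType) (p : nat) : Type := 'rV[R]_p.

Definition lebesgue_display : measure_display.
Proof. exact: default_measure_display. Qed.

Section lebesgue.
Variables (R : realType) (p : nat).

Local Notation outer := ((borel_lebesgue R p)^*)%mu.

HB.instance Definition _ := Pointed.copy (lebesgue_rV R p) 'rV[R]_p.

HB.instance Definition _ := @isMeasurable.Build lebesgue_display
  (lebesgue_rV R p) outer.-caratheodory
  (@caratheodory_measurable_set0 R _ outer)
  (@caratheodory_measurable_setC R _ outer)
  (@caratheodory_measurable_bigcup R _ outer).

Definition lebesgue (A : set (lebesgue_rV R p)) : \bar R := outer A.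

Let lebesgue0 : lebesgue set0 = 0%E.
Proof. exact: mu_ext0. Qed.

Let lebesgue_ge0 A : (0 <= lebesgue A)%E.
Proof. exact: mu_ext_ge0. Qed.

Let lebesgue_sigma_additive : semi_sigma_additive lebesgue.
Proof.
move=> F mF tF mUF; exact: caratheodory_measure_sigma_additive.
Qed.

HB.instance Definition _ := isMeasure.Build _ _ _ lebesgue
  lebesgue0 lebesgue_ge0 lebesgue_sigma_additive.

Lemma borel_measurable (A : set 'rV[R]_p) :
  measurable A -> measurable (A : set (lebesgue_rV R p)).
Proof. exact: caratheodory_measurable_mu_ext. Qed.

Lemma lebesgueE (A : set 'rV[R]_p) :
  measurable A -> lebesgue A = borel_lebesgue R p A.
Proof. exact: measurable_mu_extE. Qed.

End lebesgue.
Arguments lebesgue {R p}.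

Section open.
Variables (R : realType) (p : nat).

Lemma open_measurable_rV (A : set 'rV[R]_p) : open A -> measurable A.
Proof.
move=> oA.
pose B (q : 'rV[rat]_p * 'rV[rat]_p) : set 'rV[R]_p :=
  [set v | forall i, ratr (q.1 0 i) < v 0 i < ratr (q.2 0 i)].
have mB q : measurable (B q).
  rewrite (_ : B q = \bigcap_(i in [set: 'I_p])
    ((fun v : 'rV[R]_p => v 0 i) @^-1` `]ratr (q.1 0 i), ratr (q.2 0 i)[)).
    apply: fin_bigcap_measurable => // i _.
    by rewrite -[X in measurable X]setTI; exact: measurable_coord.
  by apply/seteqP; split => [v Bv i _|v Bv i]; have := Bv i;
    rewrite /= in_itv/=; exact.
suff -> : A = \bigcup_q (if `[< B q `<=` A >] then B q else set0).
  apply: countable_bigcupT_measurable => // q.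
  by case: ifPn => // _; exact: measurable0.
apply/seteqP; split => [t At|t [q _]]; last first.
  by case: ifPn => // /asboolP; exact.
have /nbhs_ballP[e /= e0 teA] : nbhs t A by exact: open_nbhs_nbhs.
have lo i : exists q : rat, t 0 i - e < ratr q < t 0 i.
  have /rat_in_itvoo[q] : t 0 i - e < t 0 i by rewrite gtrBl.
  by rewrite in_itv/= => ?; exists q.
have hi i : exists q : rat, t 0 i < ratr q < t 0 i + e.
  have /rat_in_itvoo[q] : t 0 i < t 0 i + e by rewrite ltrDl.
  by rewrite in_itv/= => ?; exists q.
have [ql qlP] := choice lo; have [qh qhP] := choice hi.
exists (\row_i ql i, \row_i qh i) => //; case: ifPn => [_|].
  by move=> i; rewrite /= !mxE; case/andP: (qlP i) => _ ->;
    case/andP: (qhP i) => ->.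
case/asboolP => v Bv; apply: teA; split => // i j.
rewrite (ord1 i); have /= := Bv j; rewrite !mxE => /andP[lv vh].
case/andP: (qlP j) => l1 _; case/andP: (qhP j) => _ h1.
rewrite /ball/= ltr_distlC; apply/andP; split.
  exact: lt_trans lv.
exact: lt_trans h1.
Qed.

Lemma continuous_measurable_rV (f : 'rV[R]_p -> R) :
  continuous f -> measurable_fun [set: lebesgue_rV R p] f.
Proof.
move=> /continuousP cf; apply: (measurability _ (RGenOpens.measurableE R)).
move=> _ [_ [a [b ->] <-]]; rewrite setTI.
apply: borel_measurable; apply: (@open_measurable_rV (f @^-1` `]a, b[)).
by apply: cf; exact: interval_open.
Qed.

End open.


Section box.
Variables (R : realType) (p : nat).

Definition box (T : 'rV[R]_p) : set 'rV[R]_p :=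
  [set t | forall i, 0 <= t 0 i <= T 0 i].

Lemma borel_measurable_box T : measurable (box T).
Proof.
rewrite (_ : box T = \bigcap_(i in [set: 'I_p])
    ((fun v : 'rV[R]_p => v 0 i) @^-1` `[0, T 0 i])).
  apply: fin_bigcap_measurable => // i _.
  by rewrite -[X in measurable X]setTI; exact: measurable_coord.
by apply/seteqP; split => [v Bv i _|v Bv i]; have := Bv i;
  rewrite /= in_itv/=; exact.
Qed.

Lemma measurable_box T : measurable (box T : set (lebesgue_rV R p)).
Proof. by apply: borel_measurable; exact: borel_measurable_box. Qed.

Lemma compact_box T : compact (box T).
Proof.
have := @rV_compact R p (fun i => `[0, T 0 i]%classic).
rewrite (_ : [set v | _] = box T).
  by apply=> i; exact: segment_compact.
by apply/seteqP; split => v Bv i; have := Bv i; rewrite /= in_itv/=; exact.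
Qed.

End box.

Lemma lebesgue_box (R : realType) (p : nat) (T : 'rV[R]_p) :
  (forall i, 0 <= T 0 i) -> lebesgue (box T) = (\prod_i T 0 i)%:E.
Proof.
move=> T0; rewrite lebesgueE; last exact: borel_measurable_box.
elim: p T T0 => [T T0|p IH T T0] /=.
  rewrite big_ord0 diracE (_ : 0 \in box T = true)//.
  by apply/mem_set => -[].
rewrite /cons_measure /pushforward.
have -> : @cons_rV R p @^-1` box T =
    `[0, T 0 ord0]%classic `*` box (\row_i T 0 (lift ord0 i)).
  apply/seteqP; split => [z Bz|z [/= zT Bz] i] /=.
    split => [|i].
      by have := Bz ord0; rewrite /= cons_rV0 in_itv.
    by have := Bz (lift ord0 i); rewrite /= cons_rVS mxE.
  case: (unliftP ord0 i) => [j|] ->.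
    by have := Bz j; rewrite cons_rVS mxE.
  by move: zT; rewrite cons_rV0 in_itv.
rewrite product_measure1E//; last exact: borel_measurable_box.
rewrite IH; last by move=> i; rewrite mxE.
rewrite [X in (X * _)%E](lebesgue_measure_itv `[0, T 0 ord0])/= lte_fin big_ord_recl EFinM.
under eq_bigr do rewrite mxE.
case: ltP => [_|]; first by rewrite sube0.
by move=> T0'; rewrite (le_anti (introT andP (conj T0' (T0 ord0)))).
Qed.

Section euclidean.
Variables (R : realType) (m k : nat).
Implicit Types A B C : 'M[R]_(m, k).

Definition edot A B : R := \sum_i \sum_j A i j * B i j.

Definition enorm A : R := Num.sqrt (edot A A).

Lemma edotC A B : edot A B = edot B A.
Proof. by apply: eq_bigr => i _; apply: eq_bigr => j _; rewrite mulrC. Qed.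

Lemma edotDl A B C : edot (A + B) C = edot A C + edot B C.
Proof.
rewrite /edot -big_split/=; apply: eq_bigr => i _; rewrite -big_split/=.
by apply: eq_bigr => j _; rewrite mxE mulrDl.
Qed.

Lemma edotZl (a : R) A B : edot (a *: A) B = a * edot A B.
Proof.
rewrite /edot mulr_sumr; apply: eq_bigr => i _; rewrite mulr_sumr.
by apply: eq_bigr => j _; rewrite mxE mulrA.
Qed.

Lemma edot_ge0 A : 0 <= edot A A.
Proof. by apply: sumr_ge0 => i _; apply: sumr_ge0 => j _; rewrite -expr2 sqr_ge0. Qed.

Lemma edot_eq0 A : edot A A = 0 -> A = 0.
Proof.
move=> A0; apply/matrixP => i j; rewrite mxE; apply/eqP.
rewrite -sqrf_eq0 expr2; move/eqP: A0.
rewrite psumr_eq0; last first.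
  by move=> *; apply: sumr_ge0 => *; rewrite -expr2 sqr_ge0.
move/allP => /(_ i (mem_index_enum _))/=.
rewrite psumr_eq0; last by move=> *; rewrite -expr2 sqr_ge0.
by move/allP => /(_ j (mem_index_enum _)).
Qed.

End euclidean.

Section Sobolev.
Variables (R : realType) (p n : nat) (T : 'rV[R]_p).

Let D : set (lebesgue_rV R p) := box T.

Let mD : measurable D. Proof. exact: measurable_box. Qed.

(* Square-integrability is asked of every entry; functions on box T are total
   functions, of which only the values on box T matter. *)
Definition L2 m k (f : 'rV[R]_p -> 'M[R]_(m, k)) : Prop :=
  forall i j,
    measurable_fun (box T : set (lebesgue_rV R p)) (fun t => f t i j) /\
    lebesgue.-integrable (box T) (fun t => ((f t i j) ^+ 2)%:E).

Definition pderiv m k (f : 'rV[R]_p -> 'M[R]_(m, k)) (al : 'I_p) :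
  'rV[R]_p -> 'M[R]_(m, k) := fun t => 'D_(delta_mx 0 al) f t.

Fixpoint Ck m (k : nat) (f : 'rV[R]_p -> 'rV[R]_m) : Prop :=
  if k is k'.+1 then
    continuous f /\ forall al, (forall t, derivable f t (delta_mx 0 al)) /\
                               Ck k' (pderiv f al)
  else continuous f.

Definition CTinf (f : 'rV[R]_p -> 'rV[R]_n) : Prop :=
  (forall k, Ck k f) /\
  (forall al t, f (t + T 0 al *: delta_mx 0 al) = f t).

Definition weak_grad (u : 'rV[R]_p -> 'rV[R]_n) (Du : 'rV[R]_p -> 'M[R]_(n, p)) :
  Prop := forall f, CTinf f -> forall al,
    \int[lebesgue]_(t in box T) edot (u t) (pderiv f al t) =
    - \int[lebesgue]_(t in box T) edot (col al (Du t))^T (f t).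

Lemma L2_integrable2 m k (f g : 'rV[R]_p -> 'M[R]_(m, k)) i j :
  L2 f -> L2 g ->
  lebesgue.-integrable D (EFin \o (fun t => f t i j * g t i j)).
Proof.
move=> /(_ i j)[mf f2] /(_ i j)[mg g2].
apply: (le_integrable mD _ _ (integrableD mD f2 g2)).
  exact/measurable_EFinP/measurable_funM.
move=> t _ /=; rewrite lee_fin [leRHS]ger0_norm; last first.
  by rewrite addr_ge0// sqr_ge0.
have := sqr_ge0 (`|f t i j| - `|g t i j|).
rewrite sqrrB !real_normK ?num_real// normrM => h.
have : 0 <= `|f t i j| * `|g t i j| by rewrite mulr_ge0.
move: h; set x := `|_| * `|_|; rewrite -mulr_natr; lra.
Qed.

Lemma L2_edot m k (f g : 'rV[R]_p -> 'M[R]_(m, k)) :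
  L2 f -> L2 g ->
  lebesgue.-integrable D (EFin \o (fun t => edot (f t) (g t))).
Proof.
move=> Lf Lg.
rewrite (_ : _ \o _ = fun t => (\sum_i \sum_j (f t i j * g t i j)%:E)%E).
  apply: integrable_sum => // i _; apply: integrable_sum => // j _.
  exact: L2_integrable2.
by apply/funext => t /=; rewrite /edot -sumEFin; apply: eq_bigr => i _;
  rewrite sumEFin.
Qed.

Lemma L2D m k (f g : 'rV[R]_p -> 'M[R]_(m, k)) (a : R) :
  L2 f -> L2 g -> L2 (a *: f + g).
Proof.
move=> Lf Lg i j; have fg := L2_integrable2 i j Lf Lg.
have [mf f2] := Lf i j; have [mg g2] := Lg i j.
have E t : (a *: f + g) t i j = a * f t i j + g t i j by rewrite !fctE !mxE.
split.
  under eq_fun do rewrite E.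
  exact: measurable_funD (measurable_funM _ _) _.
have := integrableD mD (integrableZl mD (a ^+ 2) f2)
  (integrableD mD (integrableZl mD (2 * a) fg) g2).
apply: eq_integrable => // t _ /=.
by rewrite E -!EFinM -!EFinD; congr EFin; ring.
Qed.

Lemma L2_0 m k : L2 (0 : 'rV[R]_p -> 'M[R]_(m, k)).
Proof.
move=> i j.
have E t : (0 : 'rV[R]_p -> 'M[R]_(m, k)) t i j = 0 by rewrite mxE.
split; first by under eq_fun do rewrite E; exact: measurable_cst.
by under eq_fun do rewrite E expr0n; exact: integrable0.
Qed.

Lemma lebesgue_box_lty : (lebesgue D < +oo)%E.
Proof.
have [T0|] := pselect (forall i, 0 <= T 0 i).
  by rewrite lebesgue_box// ltry.
move=> /existsNP[i /negP]; rewrite -ltNge => Ti.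
rewrite (_ : D = set0) ?measure0//; apply/seteqP; split => // t /(_ i).
by move=> /andP[/le_trans/[apply]]; rewrite leNgt Ti.
Qed.

Lemma L2_continuous m k (f : 'rV[R]_p -> 'M[R]_(m, k)) : continuous f -> L2 f.
Proof.
move=> cf i j.
have cij : continuous (fun t => f t i j).
  move=> t; apply: (@continuous_comp _ _ _ f (fun A : 'M[R]_(m, k) => A i j)).
    exact: cf.
  exact: coord_continuous.
have c2 : continuous (fun t => f t i j ^+ 2).
  move=> t; apply: (@continuous_comp _ _ _ (fun t => f t i j) (fun x => x ^+ 2)).
    exact: cij.
  exact: exprn_continuous.
split; first exact/measurable_funTS/continuous_measurable_rV.
apply: (measurable_bounded_integrable mD lebesgue_box_lty).
  exact/measurable_funTS/continuous_measurable_rV.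
have : compact ((fun t : 'rV[R]_p => f t i j ^+ 2) @` box T).
  by apply: continuous_compact; [exact/continuous_subspaceT|exact: compact_box].
move=> /compact_bounded[M [Mr MP]]; exists M; split => // x Mx t Dt.
by apply: MP => //; exists t.
Qed.

Lemma Ck_continuous m k (f : 'rV[R]_p -> 'rV[R]_m) : Ck k f -> continuous f.
Proof. by case: k => [//|k []]. Qed.

Lemma CTinf_L2 f : CTinf f -> L2 f.
Proof. by move=> [/(_ 0%N)/Ck_continuous cf _]; exact: L2_continuous. Qed.

Lemma CTinf_pderiv_L2 f al : CTinf f -> L2 (pderiv f al).
Proof.
move=> [/(_ 1%N)/=[_ /(_ al)[_ cf]] _]; exact: L2_continuous.
Qed.

Lemma L2_col al (w : 'rV[R]_p -> 'M[R]_(n, p)) :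
  L2 w -> L2 (fun t => (col al (w t))^T).
Proof.
move=> Lw i j; have [mw w2] := Lw j al; split.
  by under eq_fun do rewrite !mxE.
by under eq_fun do rewrite !mxE.
Qed.

(* A weakly differentiable function is represented together with its weak
   gradient, Du i al being the derivative of u^i in t^al. Since the test functions
   are dense in L^2, u determines Du almost everywhere, so that adding the second
   component does not change the space. *)
Definition W_base : lmodType R :=
  (('rV[R]_p -> 'rV[R]_n) * ('rV[R]_p -> 'M[R]_(n, p)))%type.

Definition W_pred : {pred W_base} :=
  mem [set f : W_base | [/\ L2 f.1, L2 f.2 & weak_grad f.1 f.2]].

Lemma Rint_edotD m k (f g h : 'rV[R]_p -> 'M[R]_(m, k)) (a : R) :
  L2 f -> L2 g -> L2 h ->
  \int[lebesgue]_(t in D) edot ((a *: f + g) t) (h t) =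
  a * \int[lebesgue]_(t in D) edot (f t) (h t) +
  \int[lebesgue]_(t in D) edot (g t) (h t).
Proof.
move=> Lf Lg Lh.
under eq_Rintegral do rewrite !fctE edotDl edotZl.
rewrite RintegralD//; last exact: L2_edot.
  by rewrite RintegralZl//; exact: L2_edot.
have := integrableZl mD a (L2_edot Lf Lh).
by apply: eq_integrable => // t _ /=; rewrite EFinM.
Qed.

Lemma W_pred_submod : submod_closed W_pred.
Proof.
split.
  apply/mem_set; split; [exact: L2_0|exact: L2_0|move=> f _ al].
  have I0 m k (h g : 'rV[R]_p -> 'M[R]_(m, k)) : (forall t, h t = 0) ->
      \int[lebesgue]_(t in D) edot (h t) (g t) = 0.
    move=> h0; under eq_Rintegral do rewrite h0 -(scale0r 0) edotZl mul0r.
    by rewrite Rintegral_cst// mul0r.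
  rewrite I0// I0 ?oppr0// => t; apply/matrixP => i j.
  by rewrite !mxE.
move=> a f g /set_mem[f1 f2 wf] /set_mem[g1 g2 wg]; apply/mem_set.
split; [exact: L2D|exact: L2D|move=> h Ch al].
have -> : (a *: f + g).1 = a *: f.1 + g.1 by [].
have -> : (a *: f + g).2 = a *: f.2 + g.2 by [].
rewrite (Rint_edotD a f1 g1 (CTinf_pderiv_L2 al Ch)).
have := Rint_edotD a (L2_col al f2) (L2_col al g2) (CTinf_L2 Ch).
rewrite (wf _ Ch) (wg _ Ch) mulrN -opprD => <-; congr (- _).
apply: eq_Rintegral => t _; congr (edot _ _).
by apply/matrixP => i j; rewrite !fctE !mxE.
Qed.

HB.instance Definition _ := GRing.isSubmodClosed.Build R W_base W_pred
  W_pred_submod.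

Record preW := PreW { preW_val : W_base; preW_valP : preW_val \in W_pred }.

HB.instance Definition _ := [isSub for preW_val].
HB.instance Definition _ := [Choice of preW by <:].
HB.instance Definition _ := [SubChoice_isSubLmodule of preW by <:].

Definition preW_fun (f : preW) : 'rV[R]_p -> 'rV[R]_n := (preW_val f).1.
Definition preW_grad (f : preW) : 'rV[R]_p -> 'M[R]_(n, p) := (preW_val f).2.

Definition preW_ip (f g : preW) : R :=
  \int[lebesgue]_(t in box T)
    (edot (preW_fun f t) (preW_fun g t) + edot (preW_grad f t) (preW_grad g t)).

Definition preW_norm f := Num.sqrt (preW_ip f f).

Lemma preW_ipP f :
  [/\ L2 (preW_fun f), L2 (preW_grad f) & weak_grad (preW_fun f) (preW_grad f)].
Proof. exact: (set_mem (valP f)). Qed.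

Lemma preW_ip_integrable f g : lebesgue.-integrable D (EFin \o (fun t =>
    edot (preW_fun f t) (preW_fun g t) + edot (preW_grad f t) (preW_grad g t))).
Proof.
have [f1 f2 _] := preW_ipP f; have [g1 g2 _] := preW_ipP g.
have := integrableD mD (L2_edot f1 g1) (L2_edot f2 g2).
by apply: eq_integrable => // t _ /=; rewrite EFinD.
Qed.

Lemma preW_ipC f g : preW_ip f g = preW_ip g f.
Proof.
by apply: eq_Rintegral => t _; rewrite edotC [X in _ + X]edotC.
Qed.

Lemma preW_funP a f g : preW_fun (a *: f + g) = a *: preW_fun f + preW_fun g.
Proof. by []. Qed.

Lemma preW_gradP a f g :
  preW_grad (a *: f + g) = a *: preW_grad f + preW_grad g.
Proof. by []. Qed.

Lemma preW_ipD a f g h :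
  preW_ip (a *: f + g) h = a * preW_ip f h + preW_ip g h.
Proof.
rewrite /preW_ip -RintegralZl//; last exact: preW_ip_integrable.
rewrite -RintegralD//; last exact: preW_ip_integrable.
  apply: eq_Rintegral => t _; rewrite preW_funP preW_gradP !fctE !edotDl !edotZl; ring.
have := integrableZl mD a (preW_ip_integrable f h).
by apply: eq_integrable => // t _ /=; rewrite EFinM.
Qed.

Lemma preW_ip_ge0 f : 0 <= preW_ip f f.
Proof. by apply: Rintegral_ge0 => t _; rewrite addr_ge0// edot_ge0. Qed.

Lemma preW_ip_quad a f g : preW_ip (a *: f + g) (a *: f + g) =
  a ^+ 2 * preW_ip f f + 2 * a * preW_ip f g + preW_ip g g.
Proof.
rewrite preW_ipD (preW_ipC f (_ + _)) (preW_ipC g (_ + _)) !preW_ipD (preW_ipC g f).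
ring.
Qed.

Lemma preW_ip_CS f g : preW_ip f g <= preW_norm f * preW_norm g.
Proof.
have A0 := preW_ip_ge0 f; have C0 := preW_ip_ge0 g.
have Q a : 0 <= a ^+ 2 * preW_ip f f + 2 * a * preW_ip f g + preW_ip g g.
  by rewrite -preW_ip_quad preW_ip_ge0.
apply: le_trans (ler_norm _) _.
rewrite /preW_norm -sqrtrM// -sqrtr_sqr ler_wsqrtr//.
move: A0 C0 Q; move: (preW_ip f f) (preW_ip f g) (preW_ip g g) => A B C A0 C0 Q.
have [A0'|A0'] := eqVneq A 0.
  have [->|B0] := eqVneq B 0; first by rewrite expr0n/= mulr_ge0.
  have := Q (- (C + 1) / (2 * B)).
  rewrite A0' mulr0 add0r (_ : 2 * _ * B = - (C + 1)); first lra.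
  by field.
have Ap : 0 < A by rewrite lt_neqAle eq_sym A0'.
have := Q (- B / A).
rewrite (_ : _ + _ + C = (A * C - B ^+ 2) / A); last by field.
by rewrite pmulr_lge0 ?invr_gt0// subr_ge0.
Qed.

Lemma ler_preW_normD f g : preW_norm (f + g) <= preW_norm f + preW_norm g.
Proof.
have fg0 : 0 <= preW_norm f + preW_norm g by rewrite addr_ge0 ?sqrtr_ge0.
rewrite -(ger0_norm fg0) -sqrtr_sqr ler_wsqrtr//.
rewrite -[f in leLHS]scale1r preW_ip_quad sqrrD !sqr_sqrtr ?preW_ip_ge0//.
move: (preW_ip_CS f g).
move: (preW_norm f * preW_norm g) (preW_ip f f) (preW_ip f g) (preW_ip g g).
by move=> x A B C; rewrite expr1n -mulr_natr; lra.
Qed.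

Lemma preW_normZ a f : preW_norm (a *: f) = `|a| * preW_norm f.
Proof.
rewrite /preW_norm -[a *: f]addr0 preW_ip_quad.
have i0 g : preW_ip 0 g = 0.
  by rewrite -[0 in LHS](scale0r 0) -[_ *: _]addr0 preW_ipD mul0r add0r;
     have := preW_ipD (-1) 0 0 g; rewrite scaler0 addr0 mulN1r addNr.
by rewrite (preW_ipC f) !i0 mulr0 !addr0 sqrtrM ?sqr_ge0// sqrtr_sqr.
Qed.

Definition W_null : {pred preW} := mem [set f |
  {ae @lebesgue R p, forall t, box T t ->
    preW_fun f t = 0 /\ preW_grad f t = 0}].

Lemma W_nullP f : (f \in W_null) = (preW_norm f == 0).
Proof.
pose F t := edot (preW_fun f t) (preW_fun f t) +
            edot (preW_grad f t) (preW_grad f t).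
have F0 t : 0 <= F t by rewrite addr_ge0// edot_ge0.
have iF : lebesgue.-integrable D (EFin \o F) := preW_ip_integrable f f.
have mF : measurable_fun D (EFin \o F) by case/integrableP: iF.
have FE : (\int[lebesgue]_(t in D) `|(EFin \o F) t| = (preW_ip f f)%:E)%E.
  rewrite /preW_ip /Rintegral -[LHS]fineK; last first.
    by apply: integrable_fin_num => //; exact: integrable_abse.
  by congr (fine _)%:E; apply: eq_integral => t _ /=; rewrite ger0_norm.
have aeP : ae_eq lebesgue D (EFin \o F) (cst 0%E) <-> preW_norm f = 0.
  rewrite -(ae_eq_integral_abs _ mD mF) FE; split => [[]|/eqP].
    by rewrite /preW_norm => ->; rewrite sqrtr0.
  by rewrite sqrtr_eq0 => le0; congr EFin; apply/le_anti; rewrite le0 preW_ip_ge0.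
apply/idP/eqP => [/set_mem/= fn|/aeP fn].
  apply/aeP; apply: (filterS (F := almost_everywhere (@lebesgue R p)) _ fn) => t h Dt; have [/= u0 g0] := h Dt.
  by rewrite /F u0 g0 -[0 in X in edot X _](scale0r 0)
     -[0 in X in _ + edot X _](scale0r 0) !edotZl !mul0r addr0.
apply/mem_set; apply: (filterS (F := almost_everywhere (@lebesgue R p)) _ fn) => t h Dt; have /= [/eqP] := h Dt.
rewrite /F paddr_eq0 ?edot_ge0// => /andP[/eqP/edot_eq0 -> /eqP/edot_eq0 ->].
by [].
Qed.

Lemma W_null_zmod : zmod_closed W_null.
Proof.
split; first by rewrite W_nullP -(scale0r 0) preW_normZ normr0 mul0r.
move=> f g; rewrite !W_nullP => /eqP f0 /eqP g0.
rewrite -scaleN1r -(rwP eqP); apply/le_anti; rewrite sqrtr_ge0 andbT.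
by apply: le_trans (ler_preW_normD _ _) _; rewrite preW_normZ f0 g0 mulr0 addr0.
Qed.

HB.instance Definition _ := GRing.isZmodClosed.Build preW W_null W_null_zmod.

(* Equality almost everywhere on box T. *)
Definition W := Quotient.quot W_null.

HB.instance Definition _ := Choice.on W.
HB.instance Definition _ := GRing.Zmodule.on W.
HB.instance Definition _ := EqQuotient.on W.

(* The values of an arbitrary representative. *)
Definition W_fun (u : W) := preW_fun (repr u).
Definition W_grad (u : W) := preW_grad (repr u).

Definition W_ip (u v : W) : R := preW_ip (repr u) (repr v).
Definition W_norm (u : W) : R := Num.sqrt (W_ip u u).

Lemma W_normE f : W_norm (\pi_W f) = preW_norm f.
Proof.
rewrite /W_norm /W_ip -/(preW_norm _).
have : repr (\pi_W f) - f \in W_null.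
  by rewrite Quotient.idealrBE reprK.
rewrite W_nullP => /eqP h.
have h' : preW_norm (f - repr (\pi_W f)) = 0.
  by rewrite -opprB -scaleN1r preW_normZ h mulr0.
apply/le_anti/andP; split.
  rewrite -{1}(subrK f (repr _)); apply: le_trans (ler_preW_normD _ _) _.
  by rewrite h add0r.
rewrite -{1}(subrK (repr (\pi_W f)) f); apply: le_trans (ler_preW_normD _ _) _.
by rewrite h' add0r.
Qed.

Definition W_scale (a : R) (u : W) : W := \pi_W (a *: repr u).

Lemma pi_scale a f : W_scale a (\pi_W f) = \pi_W (a *: f).
Proof.
apply/eqP; rewrite /W_scale -Quotient.idealrBE -scalerBr W_nullP preW_normZ.
have : repr (\pi_W f) - f \in W_null.
  by rewrite Quotient.idealrBE reprK.
by rewrite W_nullP => /eqP ->; rewrite mulr0.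
Qed.

Lemma pi_addW f g : \pi_W f + \pi_W g = \pi_W (f + g).
Proof. exact/esym/raddfD. Qed.

Lemma W_scaleA a b u : W_scale a (W_scale b u) = W_scale (a * b) u.
Proof. by rewrite -[u]reprK [W_scale b _]pi_scale !pi_scale scalerA. Qed.

Lemma W_scale1 : left_id 1 W_scale.
Proof. by move=> u; rewrite -[u]reprK pi_scale scale1r. Qed.

Lemma W_scaleDr : right_distributive W_scale +%R.
Proof.
by move=> a u v; rewrite -[u]reprK -[v]reprK pi_addW !pi_scale pi_addW scalerDr.
Qed.

Lemma W_scaleDl u : {morph W_scale^~ u : a b / a + b}.
Proof.
by move=> a b; rewrite -[u]reprK !pi_scale pi_addW scalerDl.
Qed.

HB.instance Definition _ := GRing.Zmodule_isLmodule.Build R W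
  W_scaleA W_scale1 W_scaleDr W_scaleDl.

Lemma ler_W_normD u v : W_norm (u + v) <= W_norm u + W_norm v.
Proof. by rewrite -[u]reprK -[v]reprK pi_addW !W_normE ler_preW_normD. Qed.

Lemma W_normZ a u : W_norm (a *: u) = `|a| * W_norm u.
Proof.
by rewrite -[u]reprK [_ *: _]pi_scale !W_normE preW_normZ.
Qed.

Lemma W_norm_eq0 u : W_norm u = 0 -> u = 0.
Proof.
rewrite -[u]reprK W_normE => u0; rewrite -[RHS](raddf0 \pi_W).
by apply/eqP; rewrite -Quotient.idealrBE subr0 W_nullP u0.
Qed.

HB.instance Definition _ := Lmodule_isNormed.Build R W
  ler_W_normD W_normZ W_norm_eq0.

Lemma W_repr_ae f : {ae @lebesgue R p, forall t, box T t ->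
  W_fun (\pi_W f) t = preW_fun f t /\ W_grad (\pi_W f) t = preW_grad f t}.
Proof.
have : repr (\pi_W f) - f \in W_null by rewrite Quotient.idealrBE reprK.
move=> /set_mem/= h.
apply: (filterS (F := almost_everywhere (@lebesgue R p)) _ h) => t ht Dt.
have [u0 g0] := ht Dt; split; apply/eqP; rewrite -subr_eq0; apply/eqP.
  exact: u0.
exact: g0.
Qed.

End Sobolev.
Arguments W {R p} n T.

Section lagrangian.
Variables (R : realType) (p n : nat).

Definition egrad m k (g : 'M[R]_(m, k) -> R) (z : 'M[R]_(m, k)) :
  'M[R]_(m, k) := \matrix_(i, j) 'D_(delta_mx i j) g z.

Implicit Type L : 'rV[R]_p -> 'rV[R]_n -> 'M[R]_(n, p) -> R.

Definition grad_x L t x y : 'rV[R]_n := egrad (fun x' => L t x' y) x.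

Definition grad_y L t x y : 'M[R]_(n, p) := egrad (fun y' => L t x y') y.

Definition continuous_partials L t : Prop :=
  [/\ forall x y i, derivable (fun x' => L t x' y) x (delta_mx 0 i),
      forall x y i al, derivable (fun y' => L t x y') y (delta_mx i al),
      continuous (fun z : 'rV[R]_n * 'M[R]_(n, p) => grad_x L t z.1 z.2) &
      continuous (fun z : 'rV[R]_n * 'M[R]_(n, p) => grad_y L t z.1 z.2)].

Definition action (T : 'rV[R]_p) L (u : W n T) : R :=
  \int[lebesgue]_(t in box T) L t (W_fun u t) (W_grad u t).

End lagrangian.

(* The derivative is one-sided at 0; a is arbitrary on negative numbers. *)
Definition C1_halfline (R : realType) (a a' : R -> R) : Prop :=
  (forall s, 0 <= s ->
    h^-1 * (a (s + h) - a s) @[h --> within [set h | 0 <= s + h] 0^'] --> a' s) /\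
  {within `[0, +oo[, continuous a'}.

(* The norm of the dual space, meaningful for bounded linear l. *)
Definition dual_norm (R : realType) (V : normedModType R) (l : V -> R) : R :=
  sup [set `|l v| | v in [set v : V | `|v| <= 1]].

Definition continuously_differentiable (R : realType) (V : normedModType R)
    (phi : V -> R) : Prop :=
  (forall u, differentiable phi u) /\
  (forall u, dual_norm (fun v => 'd phi w v - 'd phi u v) @[w --> u] --> 0).

(* Main.v *)
Require Import Defs.
From HB Require Import structures.
From mathcomp Require Import all_boot all_order all_algebra.
From mathcomp Require Import all_classical all_reals all_analysis.
From mathcomp Require Import measurable_realfun lra ring.

Set Implicit Arguments.
Unset Strict Implicit.
Unset Printing Implicit Defensive.

Import Order.TTheory GRing.Theory Num.Theory.
Import numFieldNormedType.Exports.

Local Open Scope classical_set_scope.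
Local Open Scope ring_scope.

(** Put z = (u, du/dt) and let g(t, z) be the full (x, y)-gradient of L. Since a'
    is bounded above, a grows at most linearly, so that |g(t, z)| <= C (1 + |z|).
    For u in L^2, let H_K(t) be the supremum over v of
    |g(t, u(t) + v) - g(t, u(t))| - K |v|. It is dominated by a multiple of
    1 + |u(t)| and tends to 0 pointwise as K grows, hence H_K -> 0 in L^2 by
    dominated convergence. The resulting bound
    |g(t, u + v) - g(t, u)| <= H_K(t) + K |v|, valid for all v with H_K as small as
    desired in L^2, gives by the mean value theorem and Cauchy-Schwarz both the
    first-order expansion of the functional and the continuity of its derivative. *)

(** * The l1 norm and the mean value theorem for matrices *)

(** The obstacle is that an increment small in L^2 need not be small pointwise, so the pointwise
    continuity of g cannot be used directly. The term K |v| takes care of the large values of the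
    increment, at a cost that vanishes with its norm because K is fixed before the increment is
    chosen; no subsequence converging almost everywhere has to be extracted. K is kept at least C,
    so that the linear growth of g cannot make the supremum infinite, and the supremum runs over a
    countable dense set so that H_K is measurable. Elements of [W] are classes modulo null sets, and
    a chosen representative respects sums only almost everywhere; the integral functional is
    therefore studied on an abstract normed space with a map into square-integrable functions that
    is linear almost everywhere. On matrices the sum of the absolute values of the entries serves as
    norm: it fits a mean value argument that moves one coordinate at a time, and it is equivalent to
    the Euclidean norm up to a dimension constant. *)

Section l1_norm.
Variables (R : realType) (m k : nat).
Implicit Types A B G : 'M[R]_(m, k).

Definition l1 A : R := \sum_i \sum_j `|A i j|.

Lemma l1_ge0 A : 0 <= l1 A.
Proof. by apply: sumr_ge0 => i _; apply: sumr_ge0. Qed.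

Lemma le_l1 A B : (forall i j, `|A i j| <= `|B i j|) -> l1 A <= l1 B.
Proof. by move=> AB; apply: ler_sum => i _; apply: ler_sum. Qed.

Lemma l1D A B : l1 (A + B) <= l1 A + l1 B.
Proof.
rewrite /l1 -big_split/=; apply: ler_sum => i _; rewrite -big_split/=.
by apply: ler_sum => j _; rewrite mxE ler_normD.
Qed.

Lemma l1N A : l1 (- A) = l1 A.
Proof. by apply: eq_bigr => i _; apply: eq_bigr => j _; rewrite mxE normrN. Qed.

Lemma coord_le_l1 A i j : `|A i j| <= l1 A.
Proof.
rewrite /l1 (bigD1 i)//= (bigD1 j)//= -addrA lerDl addr_ge0 ?sumr_ge0//.
by move=> *; exact: sumr_ge0.
Qed.

Lemma edot_le_l1 A B : `|edot A B| <= l1 A * l1 B.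
Proof.
rewrite /edot /l1 mulr_suml; apply: le_trans (ler_norm_sum _ _ _) _.
apply: ler_sum => i _; rewrite mulr_suml; apply: le_trans (ler_norm_sum _ _ _) _.
by apply: ler_sum => j _; rewrite normrM ler_wpM2l// coord_le_l1.
Qed.

Lemma enorm_ge0 A : 0 <= enorm A.
Proof. exact: sqrtr_ge0. Qed.

Lemma enorm_le_l1 A : enorm A <= l1 A.
Proof.
rewrite -(ger0_norm (l1_ge0 A)) -sqrtr_sqr ler_wsqrtr// expr2.
exact: le_trans (ler_norm _) (edot_le_l1 _ _).
Qed.

Lemma coord_le_enorm A i j : `|A i j| <= enorm A.
Proof.
rewrite -sqrtr_sqr ler_wsqrtr// /edot (bigD1 i)//= (bigD1 j)//= -addrA -expr2.
rewrite lerDl addr_ge0 ?sumr_ge0// => *; rewrite -?expr2 ?sqr_ge0//.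
by apply: sumr_ge0 => *; rewrite -expr2 sqr_ge0.
Qed.

Lemma l1_le_enorm A : l1 A <= (m * k)%:R * enorm A.
Proof.
apply: (@le_trans _ _ (\sum_(i < m) \sum_(j < k) enorm A)).
  by apply: ler_sum => i _; apply: ler_sum => j _; exact: coord_le_enorm.
by rewrite !sumr_const !card_ord -mulrnA mulr_natl mulnC.
Qed.

Lemma norm_le_l1 A : `|A| <= l1 A.
Proof.
rewrite [leLHS]mx_normrE; apply: bigmax_le => [|[i j] _]; first exact: l1_ge0.
exact: coord_le_l1.
Qed.

Lemma l1_continuous : continuous l1.
Proof.
apply: continuous_big => [x|i _]; first exact: add_continuous.
apply: continuous_big => [x|j _ A]; first exact: add_continuous.
apply: (@continuous_comp _ _ _ (fun A : 'M[R]_(m, k) => A i j) Num.norm).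
  exact: coord_continuous.
exact: norm_continuous.
Qed.

End l1_norm.

Section mean_value.
Variables (R : realType) (m k : nat).
Implicit Types A B G : 'M[R]_(m, k).

Lemma is_derive_line (f : 'M[R]_(m, k) -> R) A v s :
  derivable f (A + s *: v) v ->
  is_derive s 1 (fun s => f (A + s *: v)) ('D_v f (A + s *: v)).
Proof.
move=> df.
have E : (fun h : R => h^-1 *: (((fun s => f (A + s *: v)) \o shift s) (h *: 1) -
    f (A + s *: v))) =
    (fun h : R => h^-1 *: ((f \o shift (A + s *: v)) (h *: v) - f (A + s *: v))).
  apply/funext => h /=; congr (_ *: (f _ - _)).
  by rewrite scalerDl addrCA [h *: 1]mulr1.
by split; rewrite /derivable /derive E.
Qed.

(** The one-variable mean value theorem on the segment between 0 and [b], which may have either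
    sign. Only the modulus of [c] is recorded: it keeps the intermediate point in the box required
    by [mx_mvt]. *)
Lemma line_mvt (f : 'M[R]_(m, k) -> R) A v (b : R) :
  (forall s, derivable f (A + s *: v) v) ->
  exists2 c : R, `|c| <= `|b| &
    f (A + b *: v) - f A = 'D_v f (A + c *: v) * b.
Proof.
move=> df; have dh s := is_derive_line (df s).
have ch (x y : R) : {within `[x, y], continuous (fun s => f (A + s *: v))}.
  apply: continuous_subspaceT => s.
  by apply/differentiable_continuous/derivable1_diffP; have [] := dh s.
have [b0|b0] := leP 0 b.
  have [c] := MVT_segment b0 (fun x _ => dh x) (ch 0 b).
  rewrite in_itv/= => /andP[c0 cb]; rewrite scale0r addr0 subr0 => E.
  by exists c; rewrite // !ger0_norm.
have [c] := MVT_segment (ltW b0) (fun x _ => dh x) (ch b 0).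
rewrite in_itv/= => /andP[bc c0]; rewrite scale0r addr0 sub0r mulrN => E.
exists c; first by rewrite !ler0_norm ?lerN2// ltW.
by rewrite -opprB E opprK.
Qed.

(* Moving one coordinate at a time only requires the partial derivatives of [f],
   and only at points of the box spanned by [A] and [A + B]. *)
Lemma mx_mvt (f : 'M[R]_(m, k) -> R) A B G (c : R) :
  (forall (Z : 'M[R]_(m, k)) i j, derivable f Z (delta_mx i j)) ->
  (forall Z : 'M[R]_(m, k), (forall i j, `|Z i j| <= `|B i j|) ->
     forall i j, `|'D_(delta_mx i j) f (A + Z) - G i j| <= c) ->
  `|f (A + B) - f A - edot G B| <= c * l1 B.
Proof.
move=> df fc.
(* [Bs s] keeps the entries of [B] indexed by [s] and zeroes the others; enlarging [s] by one index
   moves one coordinate. *)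
pose Bs (s : seq ('I_m * 'I_k)) : 'M[R]_(m, k) :=
  \matrix_(i, j) if (i, j) \in s then B i j else 0.
have H s : uniq s -> `|f (A + Bs s) - f A - \sum_(q <- s) G q.1 q.2 * B q.1 q.2|
    <= c * \sum_(q <- s) `|B q.1 q.2|.
  elim: s => [_|[i j] s IH /= /andP[ijs us]].
    rewrite !big_nil (_ : Bs [::] = 0) ?addr0 ?subrr ?subr0 ?normr0 ?mulr0//.
    by apply/matrixP => i j; rewrite !mxE.
  have -> : Bs ((i, j) :: s) = Bs s + B i j *: delta_mx i j.
    apply/matrixP => i' j'; rewrite !mxE in_cons xpair_eqE.
    have [->|_] /= := eqVneq i' i; last by rewrite mulr0 addr0.
    have [->|_] /= := eqVneq j' j; last by rewrite mulr0 addr0.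
    by rewrite (negbTE ijs) mulr1 add0r.
  rewrite !big_cons/= mulrDr addrA.
  have [e eb] := line_mvt (B i j) (fun s' => df (A + Bs s + s' *: delta_mx i j) i j).
  move=> E.
  have := ler_normD (f (A + Bs s + B i j *: delta_mx i j) - f (A + Bs s) -
    G i j * B i j) (f (A + Bs s) - f A - \sum_(q <- s) G q.1 q.2 * B q.1 q.2).
  rewrite [X in `|X| <= _ -> _](_ : _ = f (A + Bs s + B i j *: delta_mx i j) - f A -
    (G i j * B i j + \sum_(q <- s) G q.1 q.2 * B q.1 q.2)); last by ring.
  move/le_trans; apply; apply: lerD; last exact: IH.
  (* The intermediate increment has entry [e] at [(i, j)], with [e] no larger than [B i j] in
     modulus, and entries of [B] or 0 elsewhere, so [fc] applies to it. *)
  rewrite E -mulrBl normrM ler_wpM2r// -addrA fc// => i' j'.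
  rewrite !mxE.
  have [->|_] /= := eqVneq i' i; last first.
    by rewrite mulr0 addr0; case: ifP; rewrite ?normr0.
  have [->|_] /= := eqVneq j' j; last first.
    by rewrite mulr0 addr0; case: ifP; rewrite ?normr0.
  by rewrite (negbTE ijs) mulr1 add0r.
have := H (index_enum _) (index_enum_uniq _).
have -> : Bs (index_enum ('I_m * 'I_k)%type) = B.
  by apply/matrixP => i j; rewrite mxE mem_index_enum.
by rewrite /edot /l1 !pair_big.
Qed.

End mean_value.

(** * Caratheodory functions *)

Section phase_space.
Variables (R : realType) (n p : nat).

Local Notation Z := ('rV[R]_n * 'M[R]_(n, p))%type.
Implicit Types z w : Z.

Definition znorm z : R := l1 z.1 + l1 z.2.

Definition zdot z w : R := edot z.1 w.1 + edot z.2 w.2.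

Lemma znorm_ge0 z : 0 <= znorm z.
Proof. by rewrite addr_ge0 ?l1_ge0. Qed.

Lemma znormD z w : znorm (z + w) <= znorm z + znorm w.
Proof. by rewrite /znorm addrACA lerD ?l1D. Qed.

Lemma znormN z : znorm (- z) = znorm z.
Proof. by rewrite /znorm !l1N. Qed.

Lemma znormB z w : znorm (z - w) <= znorm z + znorm w.
Proof. by rewrite -(znormN w) znormD. Qed.

Lemma znorm0 : znorm 0 = 0.
Proof.
have l10 a b : l1 (0 : 'M[R]_(a, b)) = 0.
  by rewrite /l1 big1// => i _; rewrite big1// => j _; rewrite mxE normr0.
by rewrite /znorm !l10 addr0.
Qed.

Lemma zdot_le z w : `|zdot z w| <= znorm z * znorm w.
Proof.
apply: le_trans (ler_normD _ _) _; rewrite /znorm mulrDl !mulrDr.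
have := mulr_ge0 (l1_ge0 z.1) (l1_ge0 w.2).
have := mulr_ge0 (l1_ge0 z.2) (l1_ge0 w.1).
have := edot_le_l1 z.1 w.1; have := edot_le_l1 z.2 w.2; lra.
Qed.

Lemma norm_le_znorm z : `|z| <= znorm z.
Proof.
rewrite prod_normE ge_max; apply/andP; split.
  by apply: le_trans (norm_le_l1 _) _; rewrite lerDl l1_ge0.
by apply: le_trans (norm_le_l1 _) _; rewrite lerDr l1_ge0.
Qed.

Lemma znorm_continuous : continuous znorm.
Proof.
move=> z; apply: cvgD.
  apply: (@continuous_comp _ _ _ fst (@l1 R 1 n)); first exact: cvg_fst.
  exact: l1_continuous.
apply: (@continuous_comp _ _ _ snd (@l1 R n p)); first exact: cvg_snd.
exact: l1_continuous.
Qed.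

(** Rounding down to multiples of 1/(k+1). The integer codes form a countable type, which serves
    twice: for the measurability of compositions and as a dense set over which suprema stay
    measurable. *)
Definition cell (k : nat) z : 'rV[int]_n * 'M[int]_(n, p) :=
  (map_mx (fun x => Num.floor (x * k.+1%:R)) z.1,
   map_mx (fun x => Num.floor (x * k.+1%:R)) z.2).

Definition grid (k : nat) (q : 'rV[int]_n * 'M[int]_(n, p)) : Z :=
  (map_mx (fun i : int => i%:~R / k.+1%:R) q.1,
   map_mx (fun i : int => i%:~R / k.+1%:R) q.2).

Lemma grid_cell k z : `|z - grid k (cell k z)| <= k.+1%:R^-1.
Proof.
have k0 : 0 < k.+1%:R :> R by rewrite ltr0n.
have H (x : R) : `|x - (Num.floor (x * k.+1%:R))%:~R / k.+1%:R| <= k.+1%:R^-1.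
  have /andP[h1 h2] := floor_itv (x * k.+1%:R).
  rewrite -{1}(mulfK (lt0r_neq0 k0) x) -mulrBl normrM [X in _ * X]gtr0_norm ?invr_gt0//.
  rewrite ler_piMl ?invr_ge0 ?ler0n// ger0_norm ?subr_ge0// lerBlDl ltW//.
  by move: h2; rewrite intrD.
have Hm a b (A : 'M[R]_(a, b)) : `|A - map_mx (fun i : int => i%:~R / k.+1%:R)
    (map_mx (fun x => Num.floor (x * k.+1%:R)) A)| <= k.+1%:R^-1.
  rewrite [leLHS]mx_normrE; apply: bigmax_le => [|[i j] _].
    by rewrite invr_ge0 ltW.
  by rewrite !mxE; exact: H.
by rewrite prod_normE ge_max !Hm.
Qed.

Lemma grid_cvg z : grid k (cell k z) @[k --> \oo] --> z.
Proof.
apply/cvgrPdist_le => e e0; near=> k.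
apply: le_trans (grid_cell k z) _; rewrite ltW//.
by near: k; exact: (near_infty_natSinv_lt (PosNum e0)).
Unshelve. all: by end_near. Qed.

End phase_space.

Section caratheodory_function.
Variables (R : realType) (n p : nat).
Variables (d : measure_display) (T : measurableType d) (D : set T).
Hypothesis mD : measurable D.

Local Notation Z := ('rV[R]_n * 'M[R]_(n, p))%type.

Definition zmeas (u : T -> Z) : Prop :=
  (forall i j, measurable_fun D (fun t => (u t).1 i j)) /\
  (forall i j, measurable_fun D (fun t => (u t).2 i j)).

Lemma zmeas_cst z : zmeas (cst z).
Proof. by split => i j; exact: measurable_cst. Qed.

Lemma zmeasD u v : zmeas u -> zmeas v -> zmeas (fun t => u t + v t).
Proof.
move=> [u1 u2] [v1 v2]; split => i j.
  under eq_fun do rewrite /= mxE; exact: measurable_funD.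
under eq_fun do rewrite /= mxE; exact: measurable_funD.
Qed.

Lemma zmeasN u : zmeas u -> zmeas (fun t => - u t).
Proof.
move=> [u1 u2]; split => i j.
  under eq_fun do rewrite /= mxE; exact: measurableT_comp.
under eq_fun do rewrite /= mxE; exact: measurableT_comp.
Qed.

Lemma zmeasB u v : zmeas u -> zmeas v -> zmeas (fun t => u t - v t).
Proof. by move=> mu mv; apply: zmeasD => //; exact: zmeasN. Qed.

Lemma measurable_l1 a b (u : T -> 'M[R]_(a, b)) :
  (forall i j, measurable_fun D (fun t => u t i j)) ->
  measurable_fun D (fun t => l1 (u t)).
Proof.
move=> mu; apply: measurable_sum => i; apply: measurable_sum => j.
exact: measurableT_comp.
Qed.

Lemma measurable_edot a b (u v : T -> 'M[R]_(a, b)) :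
  (forall i j, measurable_fun D (fun t => u t i j)) ->
  (forall i j, measurable_fun D (fun t => v t i j)) ->
  measurable_fun D (fun t => edot (u t) (v t)).
Proof.
move=> mu mv; apply: measurable_sum => i; apply: measurable_sum => j.
exact: measurable_funM.
Qed.

Lemma measurable_znorm u : zmeas u -> measurable_fun D (fun t => znorm (u t)).
Proof.
by move=> [u1 u2]; apply: measurable_funD; exact: measurable_l1.
Qed.

Lemma measurable_zdot u v : zmeas u -> zmeas v ->
  measurable_fun D (fun t => zdot (u t) (v t)).
Proof.
by move=> [u1 u2] [v1 v2]; apply: measurable_funD; exact: measurable_edot.
Qed.

Lemma measurable_cell k u q : zmeas u ->
  measurable (D `&` [set t | cell k (u t) = q]).
Proof.
move=> [mu1 mu2].
have H (f : T -> R) (i : int) : measurable_fun D f ->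
    measurable (D `&` [set t | Num.floor (f t * k.+1%:R) = i]).
  move=> mf; rewrite (_ : [set t | _] =
      (fun t => f t * k.+1%:R) @^-1` `[i%:~R, (i + 1)%:~R[%classic).
    apply: measurable_funM => //; exact: measurable_cst.
  by apply/seteqP; split => t /=; rewrite in_itv/= -floor_eq => /eqP.
have -> : D `&` [set t | cell k (u t) = q] =
    (D `&` \bigcap_(ij in [set: 'I_1 * 'I_n])
      (D `&` [set t | Num.floor ((u t).1 ij.1 ij.2 * k.+1%:R) = q.1 ij.1 ij.2])) `&`
    (D `&` \bigcap_(ij in [set: 'I_n * 'I_p])
      (D `&` [set t | Num.floor ((u t).2 ij.1 ij.2 * k.+1%:R) = q.2 ij.1 ij.2])).
  apply/seteqP; split => [t [Dt /= E]|t [[Dt h1] [_ h2]]] /=.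
    by split; split => // -[i j] _; split => //=; rewrite -E/= mxE.
  split => //; case: q h1 h2 => q1 q2 h1 h2; congr pair; apply/matrixP => i j.
    by rewrite mxE; have [_] := h1 (i, j) I.
  by rewrite mxE; have [_] := h2 (i, j) I.
by apply: measurableI; apply: measurableI => //; apply: fin_bigcap_measurable => //;
  move=> ij _; exact: H.
Qed.

(* [u] is approximated by its roundings to grids, which take countably many values. *)
Lemma measurable_caratheodory (f : T -> Z -> R) u :
  (forall z, measurable_fun D (f^~ z)) ->
  (forall t, D t -> continuous (f t)) ->
  zmeas u -> measurable_fun D (fun t => f t (u t)).
Proof.
move=> mf cf mu.
apply: (@measurable_fun_cvg _ _ _ _ (fun k t => f t (grid R k (cell k (u t))))).
  move=> k _ Y mY.
  (* On each of the countably many pieces where the rounding has a fixed value [q], the second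
     argument of [f] is constant. *)
  have -> : D `&` (fun t => f t (grid R k (cell k (u t)))) @^-1` Y =
     \bigcup_q ((D `&` [set t | cell k (u t) = q]) `&`
                (D `&` (f^~ (grid R k q)) @^-1` Y)).
    apply/seteqP; split => [t [Dt Yt]|t [q _ [[Dt /= <-] [_ Yt]]]] //.
    by exists (cell k (u t)).
  apply: countable_bigcupT_measurable => // q; apply: measurableI.
    exact: measurable_cell.
  exact: mf.
move=> t Dt; apply: (@continuous_cvg _ _ _ \oo) (@grid_cvg R n p (u t)).
exact: cf.
Qed.

End caratheodory_function.

(** * Modulus of continuity of a Nemytskii operator *)

Section square_integrable.
Variables (d : measure_display) (T : measurableType d) (R : realType).
Variables (mu : {measure set T -> \bar R}) (D : set T).
Hypothesis mD : measurable D.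
Implicit Types f g F G : T -> R.

Lemma dominated_integrableR f F : measurable_fun D f ->
  mu.-integrable D (EFin \o F) -> (forall t, D t -> `|f t| <= F t) ->
  mu.-integrable D (EFin \o f).
Proof.
move=> mf iF fF; apply: (le_integrable mD _ _ iF).
  exact/measurable_EFinP.
by move=> t Dt; rewrite /= lee_fin; apply: le_trans (fF _ Dt) (ler_norm _).
Qed.

Lemma integrableDR f g : mu.-integrable D (EFin \o f) ->
  mu.-integrable D (EFin \o g) -> mu.-integrable D (EFin \o (fun t => f t + g t)).
Proof. exact: integrableD. Qed.

Lemma integrableBR f g : mu.-integrable D (EFin \o f) ->
  mu.-integrable D (EFin \o g) -> mu.-integrable D (EFin \o (fun t => f t - g t)).
Proof. exact: integrableB. Qed.

Lemma integrableZR c f : mu.-integrable D (EFin \o f) ->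
  mu.-integrable D (EFin \o (fun t => c * f t)).
Proof. exact: integrableZl. Qed.

Lemma integrable_measurableR f : mu.-integrable D (EFin \o f) -> measurable_fun D f.
Proof. by move=> /integrableP[/measurable_EFinP]. Qed.

Definition sqint f : Prop :=
  measurable_fun D f /\ mu.-integrable D (EFin \o (fun t => f t ^+ 2)).

Lemma sqint_le f F : measurable_fun D f -> sqint F ->
  (forall t, D t -> `|f t| <= F t) -> sqint f.
Proof.
move=> mf [mF iF] fF; split=> //; apply: dominated_integrableR iF _.
  exact: measurable_funX.
by move=> t Dt; rewrite normrX lerXn2r ?nnegrE ?fF// (le_trans _ (fF t Dt)).
Qed.

Lemma sqintM f g : sqint f -> sqint g ->
  mu.-integrable D (EFin \o (fun t => f t * g t)).
Proof.
move=> [mf f2] [mg g2]; apply: dominated_integrableR (integrableDR f2 g2) _.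
  exact: measurable_funM.
move=> t _; have := sqr_ge0 (`|f t| - `|g t|).
rewrite sqrrB !real_normK ?num_real// normrM => h.
have : 0 <= `|f t| * `|g t| by rewrite mulr_ge0.
by move: h; set x := `|_| * `|_|; rewrite -mulr_natr; lra.
Qed.

Lemma sqintD f g : sqint f -> sqint g -> sqint (fun t => f t + g t).
Proof.
move=> sf sg; have fg := sqintM sf sg; move: sf sg => [mf f2] [mg g2]; split.
  exact: measurable_funD.
have := integrableDR f2 (integrableDR (integrableZR 2 fg) g2).
by apply: eq_integrable => // t _ /=; congr EFin; ring.
Qed.

Lemma sqintZ c f : sqint f -> sqint (fun t => c * f t).
Proof.
move=> [mf f2]; split; first by apply: measurable_funM => //; exact: measurable_cst.
have := integrableZR (c ^+ 2) f2.
by apply: eq_integrable => // t _ /=; congr EFin; rewrite exprMn.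
Qed.

Lemma sqint_cst c : (mu D < +oo)%E -> sqint (fun=> c).
Proof.
move=> muD; split; first exact: measurable_cst.
apply: measurable_bounded_integrable => //; exists `|c ^+ 2|; split => // x cx t _ /=.
exact: ltW.
Qed.

Lemma sqint_integrable f : (mu D < +oo)%E -> sqint f ->
  mu.-integrable D (EFin \o f).
Proof.
move=> muD sf; have := sqintM sf (sqint_cst 1 muD).
by apply: eq_integrable => // t _ /=; rewrite mulr1.
Qed.

(** Integrating 2 f g <= (b/a) f^2 + (a/b) g^2 gives the bound [a * b] for all positive [a >= al]
    and [b >= be]; a limit then admits [al] or [be] equal to 0. Upper bounds in place of the norms
    themselves allow norm estimates to be inserted directly. *)
Lemma cauchy_schwarz f g (al be : R) : sqint f -> sqint g -> 0 <= al -> 0 <= be ->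
  \int[mu]_(t in D) (f t ^+ 2) <= al ^+ 2 ->
  \int[mu]_(t in D) (g t ^+ 2) <= be ^+ 2 ->
  \int[mu]_(t in D) (f t * g t) <= al * be.
Proof.
move=> sf sg al0 be0 fal gbe; have fg := sqintM sf sg.
have H (a b : R) : 0 < a -> 0 < b -> al <= a -> be <= b ->
    \int[mu]_(t in D) (f t * g t) <= a * b.
  move=> a0 b0 ala beb.
  have i1 : mu.-integrable D (EFin \o (fun t => b / a * (f t ^+ 2) + a / b * (g t ^+ 2))).
    by apply: integrableDR; apply: integrableZR; [case: sf|case: sg].
  have : \int[mu]_(t in D) (2 * (f t * g t)) <=
         \int[mu]_(t in D) (b / a * (f t ^+ 2) + a / b * (g t ^+ 2)).
    apply: le_Rintegral => //; first exact: integrableZR.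
    move=> t _; rewrite -subr_ge0.
    rewrite (_ : _ - _ = (b * f t - a * g t) ^+ 2 / (a * b)); last first.
      by field; rewrite !gt_eqF.
    by rewrite divr_ge0 ?sqr_ge0// mulr_ge0// ltW.
  rewrite RintegralZl// RintegralD//; last 2 first.
    by apply: integrableZR; case: sf.
    by apply: integrableZR; case: sg.
  rewrite !RintegralZl//; [|by case: sg|by case: sf].
  have fa : \int[mu]_(t in D) (f t ^+ 2) <= a ^+ 2.
    by apply: le_trans fal _; rewrite lerXn2r ?nnegrE// ltW.
  have gb : \int[mu]_(t in D) (g t ^+ 2) <= b ^+ 2.
    by apply: le_trans gbe _; rewrite lerXn2r ?nnegrE// ltW.
  have := ler_wpM2l (ltW (divr_gt0 b0 a0)) fa.
  have := ler_wpM2l (ltW (divr_gt0 a0 b0)) gb.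
  rewrite (_ : b / a * a ^+ 2 = a * b); last by field; rewrite gt_eqF.
  rewrite (_ : a / b * b ^+ 2 = a * b); last by field; rewrite gt_eqF.
  lra.
have {}H (e : R) : 0 < e -> \int[mu]_(t in D) (f t * g t) <= (al + e) * (be + e).
  by move=> e0; apply: H; rewrite ?ltr_wpDl ?lerDl// ltW.
apply/ler_addgt0Pr => e e0.
pose s := al + be + 1; have s1 : 1 <= s by rewrite lerDr addr_ge0.
have s0 : 0 < s by apply: lt_le_trans s1.
(* With [h <= 1], the product (al + h)(be + h) exceeds al be by at most h (al + be + 1) = h s, hence
   by at most [e]. *)
pose h := Num.min 1 (e / s).
have h0 : 0 < h by rewrite lt_min ltr01 divr_gt0.
apply: le_trans (H h h0) _; rewrite mulrDl mulrDr -addrA lerD2l.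
have h1 : h <= 1 by rewrite ge_min lexx.
have hs : h * s <= e by rewrite -ler_pdivlMr// ge_min lexx orbT.
by apply: le_trans hs; rewrite /s; have := ler_wpM2l (ltW h0) h1; lra.
Qed.

End square_integrable.

(** * The modulus of a Nemytskii operator at a fixed function *)

Section nemytskii.
Variables (R : realType) (n p : nat).
Variables (d : measure_display) (T : measurableType d).
Variables (mu : {measure set T -> \bar R}) (D : set T).
Hypotheses (mD : measurable D) (muD : (mu D < +oo)%E).

Local Notation Z := ('rV[R]_n * 'M[R]_(n, p))%type.

Variables (g : T -> Z -> Z) (C : R).
Hypotheses (C0 : 0 <= C) (g_meas : forall z, zmeas D (g^~ z)).
Hypotheses (g_cont : forall t, D t -> continuous (g t)).
Hypothesis g_growth : forall t z, D t -> znorm (g t z) <= C * (1 + znorm z).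

Lemma zmeas_caratheodory u : zmeas D u -> zmeas D (fun t => g t (u t)).
Proof.
move=> mu_; split => i j.
  apply: (measurable_caratheodory mD (f := fun t z => (g t z).1 i j)) => //.
    by move=> z; case: (g_meas z).
  move=> t Dt z; apply: (@continuous_comp _ _ _ (g t) (fun w : Z => w.1 i j)).
    exact: g_cont.
  apply: (@continuous_comp _ _ _ fst (fun A : 'rV[R]_n => A i j)).
    exact: cvg_fst.
  exact: coord_continuous.
apply: (measurable_caratheodory mD (f := fun t z => (g t z).2 i j)) => //.
  by move=> z; case: (g_meas z).
move=> t Dt z; apply: (@continuous_comp _ _ _ (g t) (fun w : Z => w.2 i j)).
  exact: g_cont.
apply: (@continuous_comp _ _ _ snd (fun A : 'M[R]_(n, p) => A i j)).
  exact: cvg_snd.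
exact: coord_continuous.
Qed.

Lemma sqint_nemytskii u : zmeas D u -> sqint mu D (fun t => znorm (u t)) ->
  sqint mu D (fun t => znorm (g t (u t))).
Proof.
move=> mu_ su; apply: sqint_le (sqintZ mD C (sqintD mD (sqint_cst mD 1 muD) su)) _ => //.
  exact/measurable_znorm/zmeas_caratheodory.
by move=> t Dt; rewrite ger0_norm ?znorm_ge0// g_growth.
Qed.

Variable u : T -> Z.
Hypotheses (u_meas : zmeas D u) (u_sq : sqint mu D (fun t => znorm (u t))).

Let osc t v := znorm (g t (u t + v) - g t (u t)).

Let osc_cont t : D t -> continuous (osc t).
Proof.
move=> Dt v.
apply: (@continuous_comp _ _ _ (fun v => g t (u t + v) - g t (u t)) (@znorm R n p)).
  apply: cvgB; last exact: cvg_cst.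
  apply: (@continuous_comp _ _ _ (fun v => u t + v) (g t)); last exact: g_cont.
  by apply: cvgD; [exact: cvg_cst|exact: cvg_id].
exact: znorm_continuous.
Qed.

Let osc_le t v : D t -> osc t v <= 2 * C * (1 + znorm (u t)) + C * znorm v.
Proof.
move=> Dt; apply: le_trans (znormB _ _) _.
have h1 := g_growth (u t + v) Dt; have h2 := g_growth (u t) Dt.
have := ler_wpM2l C0 (znormD (u t) v); lra.
Qed.

(** Enumerates the points of all grids, a dense set; integers that encode no grid point are sent to
    0. *)
Let point (j : nat) : Z :=
  oapp (fun kq : nat * ('rV[int]_n * 'M[int]_(n, p)) => grid R kq.1 kq.2) 0 (unpickle j).

Let excess (K : R) (j : nat) t := osc t (point j) - K * znorm (point j).

(* The best [H] such that [osc t v <= H t + K * znorm v] for all [v]. *)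
Let modulus (K : R) t := sups ((excess K)^~ t) 0.

(** For [K >= C] the subtracted term absorbs the part C |v| of the growth of the oscillation,
    leaving a square-integrable bound independent of [K] and of the point. *)
Let excess_ub K t : C <= K -> D t ->
  ubound (range ((excess K)^~ t)) (2 * C * (1 + znorm (u t))).
Proof.
move=> CK Dt _ [j _ <-]; rewrite /excess.
have := osc_le (point j) Dt; have := ler_wpM2r (znorm_ge0 (point j)) CK; lra.
Qed.

Let sdrop0 (f : nat -> R) : sdrop f 0 = range f.
Proof. by apply/seteqP; split => _ [k _ <-]; exists k. Qed.

Let modulus_le K t (x : R) : (forall j, excess K j t <= x) -> modulus K t <= x.
Proof.
move=> ex; rewrite /modulus /sups/= sdrop0; apply: ge_sup.
  by exists (excess K 0%N t), 0%N.
by move=> _ [j _ <-].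
Qed.

(** At grid points this is the definition of the supremum; both sides are continuous in [v], so it
    passes to the limit along the roundings of [v]. *)
Let osc_le_modulus K t v : C <= K -> D t -> osc t v <= modulus K t + K * znorm v.
Proof.
move=> CK Dt.
have gv := @grid_cvg R n p v.
apply: (@ler_cvg_to _ \oo _ _ (fun k => osc t (grid R k (cell k v)))
  (fun k => modulus K t + K * znorm (grid R k (cell k v)))).
- by apply: (continuous_cvg _ (h := osc t)); [exact: osc_cont|exact: gv].
- apply: cvgD; first exact: cvg_cst.
  apply: cvgM; first exact: cvg_cst.
  by apply: (continuous_cvg _ (h := @znorm R n p)); [exact: znorm_continuous|exact: gv].
apply: nearW => k; rewrite -lerBlDr /modulus /sups/= sdrop0.
apply: ub_le_sup; first by exists (2 * C * (1 + znorm (u t))); exact: excess_ub.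
exists (pickle (k, cell k v)) => //.
by rewrite /excess /point pickleK.
Qed.

Let modulus_ge0 K t : C <= K -> D t -> 0 <= modulus K t.
Proof.
move=> CK Dt; have := osc_le_modulus 0 CK Dt.
by rewrite /osc addr0 subrr znorm0 mulr0 addr0.
Qed.

Let modulus_meas K : C <= K -> measurable_fun D (modulus K).
Proof.
move=> CK; apply: measurable_fun_sups.
  by move=> t Dt; exists (2 * C * (1 + znorm (u t))); exact: excess_ub.
move=> j; apply: measurable_funB; last exact: measurable_cst.
apply/measurable_znorm/zmeasB; last exact: zmeas_caratheodory.
by apply: zmeas_caratheodory; apply: zmeasD => //; exact: zmeas_cst.
Qed.

(** Points close to 0 contribute less than [e] by continuity of [osc t], whatever [N]; at points of
    norm at least [r], a large [N] makes the excess nonpositive. *)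
Let modulus_cvg t : D t -> modulus (C + N%:R) t @[N --> \oo] --> (0 : R).
Proof.
move=> Dt; apply/cvgr0Pnorm_le => e e0.
have : nbhs (0 : Z) [set v | osc t v < e].
  have : osc t v @[v --> (0 : Z)] --> (0 : R).
    have <- : osc t 0 = 0 by rewrite /osc addr0 subrr znorm0.
    exact: osc_cont.
  move=> /cvgr0Pnorm_lt /(_ e e0); apply: filterS => v /=.
  exact: le_lt_trans (ler_norm _).
move=> /nbhs_normP[r /= r0 rosc].
near=> N.
have CN : C <= C + N%:R by rewrite lerDl.
rewrite ger0_norm ?modulus_ge0//; apply: modulus_le => j; rewrite /excess.
have [vr|rv] := ltP (znorm (point j)) r.
  have : osc t (point j) < e.
    apply: rosc; rewrite /ball_/= sub0r normrN.
    exact: le_lt_trans (norm_le_znorm _) vr.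
  have := mulr_ge0 (le_trans C0 CN) (znorm_ge0 (point j)); lra.
apply: le_trans (ltW e0).
have := osc_le (point j) Dt; set M := 2 * C * _.
(* Then M <= N r <= N |v|, so the growth bound M + C |v| is at most (C + N) |v|. *)
have : M / r <= N%:R by near: N; exact: nbhs_infty_ger.
rewrite ler_pdivrMr// => MN.
have := ler_wpM2l (ler0n R N) rv; lra.
Unshelve. all: by end_near. Qed.

(** [K] and [H] depend on [u] and [e] but not on the increment [v], which may thus be replaced by
    any function of [t], however large at some points. *)
Lemma nemytskii_modulus (e : R) : 0 < e -> exists K H,
  [/\ 0 <= K, sqint mu D H, \int[mu]_(t in D) (H t ^+ 2) <= e &
    forall t v, D t -> znorm (g t (u t + v) - g t (u t)) <= H t + K * znorm v].
Proof.
move=> e0.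
have sM := sqintZ mD (2 * C) (sqintD mD (sqint_cst mD 1 muD) u_sq).
have CN (N : nat) : C <= C + N%:R by rewrite lerDl.
have mle N t : D t -> `|modulus (C + N%:R) t| <= 2 * C * (1 + znorm (u t)).
  move=> Dt; rewrite ger0_norm ?modulus_ge0//; apply: modulus_le => j.
  by apply: (excess_ub (CN N) Dt); exists j.
have sH N : sqint mu D (modulus (C + N%:R)).
  by apply: sqint_le sM _; [exact: mD|exact: modulus_meas|exact: mle].
pose f_ N t := (modulus (C + N%:R) t ^+ 2)%:E.
have f_cvg t : D t -> f_^~ t @ \oo --> (0 : R)%:E.
  move=> Dt; apply/(fine_cvgP (f_^~ t)); split; first exact: nearW.
  rewrite (_ : _ \o _ = fun N => modulus (C + N%:R) t * modulus (C + N%:R) t).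
    by rewrite -[0](mulr0 0); apply: cvgM; exact: modulus_cvg.
  by apply/funext => N /=; rewrite expr2.
have f_le t N : D t -> (`|f_ N t| <= ((2 * C * (1 + znorm (u t))) ^+ 2)%:E)%E.
  move=> Dt; rewrite /= lee_fin normrX lerXn2r ?nnegrE ?mle//.
  exact: le_trans (mle N t Dt).
have [_ _] := dominated_convergence mD (fun N => measurable_int _ (sH N).2)
  (measurable_cst _) (aeW mu f_cvg) sM.2 (aeW mu f_le).
rewrite integral0 => /fine_cvgP[].
move=> _ /cvgr0Pnorm_lt /(_ e e0)[N _ /(_ N (leqnn N))] /= h.
exists (C + N%:R), (modulus (C + N%:R)); split => //.
- exact: addr_ge0.
- by apply/ltW/(le_lt_trans (ler_norm _) h).
by move=> t v Dt; exact: osc_le_modulus.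
Qed.

End nemytskii.

(** * Integral functionals *)

Section phase_space_mean_value.
Variables (R : realType) (n p : nat).

Local Notation Z := ('rV[R]_n * 'M[R]_(n, p))%type.

Definition zgrad (f : 'rV[R]_n -> 'M[R]_(n, p) -> R) (z : Z) : Z :=
  (egrad (f^~ z.2) z.1, egrad (f z.1) z.2).

(** The x-part is moved first, at the final y, and then the y-part, at the initial x; every
    intermediate increment has norm at most [znorm v]. [G] is arbitrary: the gradient at [z] gives a
    first-order expansion, 0 a Lipschitz estimate. *)
Lemma zgrad_mvt (f : 'rV[R]_n -> 'M[R]_(n, p) -> R) (z v G : Z) (c : R) :
  (forall x y i, derivable (f^~ y) x (delta_mx 0 i)) ->
  (forall x y i j, derivable (f x) y (delta_mx i j)) ->
  (forall w, znorm w <= znorm v -> znorm (zgrad f (z + w) - G) <= c) ->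
  `|f (z + v).1 (z + v).2 - f z.1 z.2 - zdot G v| <= c * znorm v.
Proof.
move=> dx dy gc.
have xc : `|f (z.1 + v.1) (z.2 + v.2) - f z.1 (z.2 + v.2) - edot G.1 v.1| <=
    c * l1 v.1.
  apply: (mx_mvt (f := f^~ (z.2 + v.2))) => [x i j|w wv i j].
    by rewrite (ord1 i); exact: dx.
  apply: le_trans (gc (w, v.2) _); last by rewrite lerD// le_l1.
  apply: (@le_trans _ _ (l1 (zgrad f (z + (w, v.2)) - G).1)); last first.
    by rewrite lerDl l1_ge0.
  by apply: le_trans (coord_le_l1 _ i j); rewrite !mxE.
have yc : `|f z.1 (z.2 + v.2) - f z.1 z.2 - edot G.2 v.2| <= c * l1 v.2.
  apply: (mx_mvt (f := f z.1)) => [y i j|w wv i j]; first exact: dy.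
  apply: le_trans (gc (0, w) _); last first.
    by rewrite lerD ?le_l1// => i' j'; rewrite mxE normr0.
  apply: (@le_trans _ _ (l1 (zgrad f (z + (0, w)) - G).2)); last first.
    by rewrite lerDr l1_ge0.
  by apply: le_trans (coord_le_l1 _ i j); rewrite !mxE/= addr0.
rewrite [X in `|X|](_ : _ =
  (f (z.1 + v.1) (z.2 + v.2) - f z.1 (z.2 + v.2) - edot G.1 v.1) +
  (f z.1 (z.2 + v.2) - f z.1 z.2 - edot G.2 v.2)); last by rewrite /zdot/=; ring.
by apply: le_trans (ler_normD _ _) _; rewrite mulrDr lerD.
Qed.

(** Locally bounded partial derivatives make [f] locally Lipschitz, by [zgrad_mvt] with [G = 0].
    Joint continuity is what [measurable_caratheodory] asks of the integrand. *)
Lemma zgrad_growth_continuous (f : 'rV[R]_n -> 'M[R]_(n, p) -> R) (C : R) :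
  (forall x y i, derivable (f^~ y) x (delta_mx 0 i)) ->
  (forall x y i j, derivable (f x) y (delta_mx i j)) ->
  0 <= C -> (forall z, znorm (zgrad f z) <= C * (1 + znorm z)) ->
  continuous (fun z : Z => f z.1 z.2).
Proof.
move=> dx dy C0 gC z.
have fz v : `|f (z + v).1 (z + v).2 - f z.1 z.2| <=
    C * (1 + znorm z + znorm v) * znorm v.
  have -> : f (z + v).1 (z + v).2 - f z.1 z.2 =
            f (z + v).1 (z + v).2 - f z.1 z.2 - zdot 0 v.
    have := zdot_le 0 v; rewrite znorm0 mul0r normr_le0 => /eqP ->.
    by rewrite subr0.
  apply: zgrad_mvt => // w wv; rewrite subr0; apply: le_trans (gC _) _.
  by rewrite ler_wpM2l// -addrA lerD2l; apply: le_trans (znormD _ _) _; rewrite lerD2l.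
have zw : znorm (w - z) @[w --> z] --> (0 : R).
  rewrite -[0 in X in _ --> X](@znorm0 R n p) -(subrr z).
  apply: (continuous_cvg _ (h := @znorm R n p)); first exact: znorm_continuous.
  by apply: cvgB; [exact: cvg_id|exact: cvg_cst].
apply/cvgrPdist_le => e e0.
have : C * (1 + znorm z + znorm (w - z)) * znorm (w - z) @[w --> z] --> (0 : R).
  rewrite -[0 in X in _ --> X](mulr0 (C * (1 + znorm z + 0))).
  apply: cvgM => //; apply: cvgM; first exact: cvg_cst.
  by apply: cvgD => //; exact: cvg_cst.
move=> /cvgr0Pnorm_le /(_ e e0); apply: filterS => w.
apply: le_trans; rewrite distrC.
have := fz (w - z); rewrite (addrC z) subrK => /le_trans; apply; exact: ler_norm.
Qed.

End phase_space_mean_value.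

Lemma ae_eq_Rintegral (R : realType) (d : measure_display) (T : measurableType d)
    (mu : {measure set T -> \bar R}) (D : set T) (f g : T -> R) :
  measurable D -> measurable_fun D f -> measurable_fun D g ->
  {ae mu, forall t, D t -> f t = g t} ->
  \int[mu]_(t in D) f t = \int[mu]_(t in D) g t.
Proof.
move=> mD mf mg fg; congr fine; apply: ae_eq_integral => //.
- exact/measurable_EFinP.
- exact/measurable_EFinP.
- by apply: filterS fg => t fgt Dt; rewrite fgt.
Qed.

(** The order of the quantifiers is the point: [e1] is chosen before [K], which [nemytskii_modulus]
    produces from it, and [de] after. Half of the tolerance goes to each summand; [c + 1] and
    [K + 1] avoid division by 0. *)
Lemma remainder_small (R : realType) (c e : R) : 0 <= c -> 0 < e ->
  exists2 e1, 0 < e1 & forall K, 0 <= K -> exists2 de, 0 < de &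
    forall x y, 0 <= x <= de -> 0 <= y -> (e1 + K * (c * x)) * (c * y) <= e * y.
Proof.
move=> c0 e0; have c1 : 0 < c + 1 by rewrite ltr_wpDl.
have e1 : 0 < e / (2 * (c + 1)) by rewrite divr_gt0// mulr_gt0.
exists (e / (2 * (c + 1))) => // K K0.
have K1 : 0 < K + 1 by rewrite ltr_wpDl.
exists (e / (2 * (c + 1)) / ((K + 1) * (c + 1))); first by rewrite divr_gt0// mulr_gt0.
move=> x y /andP[x0]; rewrite ler_pdivlMr ?mulr_gt0// => xde y0.
rewrite mulrA ler_wpM2r//.
have Kx : K * (c * x) <= e / (2 * (c + 1)).
  apply: le_trans xde; rewrite mulrC (mulrC c) -mulrA ler_wpM2l//.
  by rewrite mulrC ler_pM ?lerDl.
apply: (@le_trans _ _ (e / (c + 1) * c)).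
  rewrite ler_wpM2r//; apply: le_trans (lerD (lexx _) Kx) _.
  by rewrite le_eqVlt; apply/orP; left; apply/eqP; field; rewrite gt_eqF.
by rewrite mulrAC ler_pdivrMr// ler_wpM2l ?lerDl// ltW.
Qed.

(** * Differentiability of an integral functional over an abstract normed space *)

Section integral_functional.
Variables (R : realType) (n p : nat).
Variables (d : measure_display) (T : measurableType d).
Variables (mu : {measure set T -> \bar R}) (D : set T).
Hypotheses (mD : measurable D) (muD : (mu D < +oo)%E).

Local Notation Z := ('rV[R]_n * 'M[R]_(n, p))%type.

Variables (F : T -> Z -> R) (g : T -> Z -> Z) (B C : R).
Hypotheses (F_meas : forall z, measurable_fun D (F^~ z)).
Hypotheses (F_cont : forall t, D t -> continuous (F t)).
Hypotheses (F_growth : forall t z, D t -> `|F t z| <= B * (1 + znorm z ^+ 2)).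
Hypothesis F_mvt : forall t z v G (c : R), D t ->
  (forall w, znorm w <= znorm v -> znorm (g t (z + w) - G) <= c) ->
  `|F t (z + v) - F t z - zdot G v| <= c * znorm v.
Hypotheses (C0 : 0 <= C) (g_meas : forall z, zmeas D (g^~ z)).
Hypotheses (g_cont : forall t, D t -> continuous (g t)).
Hypothesis g_growth : forall t z, D t -> znorm (g t z) <= C * (1 + znorm z).

(* [r] stands for the choice of a representative, linear almost everywhere only. *)
Variables (V : normedModType R) (r : V -> T -> Z) (c : R).
Hypotheses (r_meas : forall v, zmeas D (r v)) (c0 : 0 <= c).
Hypotheses (r_sq : forall v, sqint mu D (fun t => znorm (r v t))).
Hypothesis r_norm : forall v,
  \int[mu]_(t in D) (znorm (r v t) ^+ 2) <= (c * `|v|) ^+ 2.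
Hypothesis r_linear : forall (a : R) u v,
  {ae mu, forall t, D t -> r (a *: u + v) t = a *: r u t + r v t}.

Let phi u := \int[mu]_(t in D) F t (r u t).
Let dphi u v := \int[mu]_(t in D) zdot (g t (r u t)) (r v t).

Lemma integrable_functional (u : T -> Z) : zmeas D u -> sqint mu D (fun t => znorm (u t)) ->
  mu.-integrable D (EFin \o (fun t => F t (u t))).
Proof.
move=> mu_ su; have i1 : mu.-integrable D (EFin \o (fun t => 1 + znorm (u t) ^+ 2)).
  apply: integrableDR => //; last by case: su.
  exact: sqint_integrable (sqint_cst mD 1 muD).
apply: (dominated_integrableR mD _ (integrableZR mD B i1)).
  exact: (measurable_caratheodory mD F_meas F_cont).
by move=> t Dt; exact: F_growth.
Qed.

Lemma integrable_zdot (u v : T -> Z) : zmeas D u -> zmeas D v ->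
  sqint mu D (fun t => znorm (u t)) -> sqint mu D (fun t => znorm (v t)) ->
  mu.-integrable D (EFin \o (fun t => zdot (u t) (v t))).
Proof.
move=> mu_ mv su sv.
apply: (dominated_integrableR mD _ (sqintM mD su sv)).
  exact: measurable_zdot mu_ mv.
by move=> t Dt; exact: zdot_le.
Qed.

Let g_sq u : sqint mu D (fun t => znorm (g t (r u t))).
Proof. exact: (sqint_nemytskii mD muD g_meas g_cont g_growth). Qed.

Let gr_meas u : zmeas D (fun t => g t (r u t)).
Proof. exact: (zmeas_caratheodory mD g_meas g_cont). Qed.

Lemma integrable_derivative u v :
  mu.-integrable D (EFin \o (fun t => zdot (g t (r u t)) (r v t))).
Proof. exact: integrable_zdot (gr_meas u) (r_meas v) (g_sq u) (r_sq v). Qed.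

Let dphi_linear u : linear (dphi u).
Proof.
move=> a v w; suff : dphi u (a *: v + w) = a * dphi u v + dphi u w by [].
rewrite /dphi; have mz v' := measurable_zdot (gr_meas u) (r_meas v').
rewrite -RintegralZl//; last exact: integrable_derivative.
rewrite -RintegralD//; [|exact: integrableZR (integrable_derivative _ _)|
  exact: integrable_derivative].
apply: (ae_eq_Rintegral (mu := mu)) => //.
  by apply: measurable_funD => //; apply: measurable_funM => //; exact: measurable_cst.
apply: filterS (r_linear a v w) => t rt Dt; rewrite (rt Dt) /zdot /=.
by rewrite edotC edotDl edotZl [X in _ + X]edotC edotDl edotZl
   ![edot (r _ _).1 _]edotC ![edot (r _ _).2 _]edotC; ring.
Qed.

Let dphi_bounded u : exists2 M, 0 <= M & forall v, `|dphi u v| <= M * `|v|.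
Proof.
pose al := Num.sqrt (\int[mu]_(t in D) (znorm (g t (r u t)) ^+ 2)).
exists (al * c) => [|v]; first by rewrite mulr_ge0 ?sqrtr_ge0.
apply: le_trans (le_normr_Rintegral mD (integrable_derivative u v)) _.
rewrite -mulrA.
apply: (@le_trans _ _ (\int[mu]_(t in D) (znorm (g t (r u t)) * znorm (r v t)))).
  apply: le_Rintegral => //.
  - by have := integrable_norm (integrable_derivative u v).
  - exact: sqintM.
  - by move=> t _; exact: zdot_le.
apply: cauchy_schwarz; rewrite ?sqrtr_ge0 ?mulr_ge0//.
by rewrite sqr_sqrtr// Rintegral_ge0// => t _; rewrite sqr_ge0.
Qed.

(** Cauchy-Schwarz on each summand. The displacement [w] and the direction [v] are kept apart: they
    coincide in the expansion of [phi] and are independent in the continuity of its derivative. *)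
Let remainder_le H K (e : R) v w : 0 <= K -> 0 <= e -> sqint mu D H ->
  \int[mu]_(t in D) (H t ^+ 2) <= e ^+ 2 ->
  \int[mu]_(t in D) ((H t + K * znorm (r w t)) * znorm (r v t)) <=
  (e + K * (c * `|w|)) * (c * `|v|).
Proof.
move=> K0 e0 sH He.
under eq_Rintegral do rewrite mulrDl -mulrA.
rewrite RintegralD//; last 2 first.
- exact: sqintM.
- by apply: (integrableZR mD); exact: sqintM.
rewrite RintegralZl//; last exact: sqintM.
rewrite mulrDl lerD//.
  by apply: cauchy_schwarz => //; rewrite mulr_ge0.
by rewrite -mulrA ler_wpM2l//; apply: cauchy_schwarz; rewrite ?mulr_ge0.
Qed.

Let remainder_integrable H K v w : sqint mu D H ->
  mu.-integrable D (EFin \o (fun t => (H t + K * znorm (r w t)) * znorm (r v t))).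
Proof.
by move=> sH; apply: sqintM => //; apply: sqintD => //; exact: sqintZ.
Qed.

Let rD u v : {ae mu, forall t, D t -> r (u + v) t = r u t + r v t}.
Proof.
by have := r_linear 1 u v; apply: filterS => t rt Dt;
  rewrite -[u in LHS]scale1r rt// scale1r.
Qed.

Let rB u v : {ae mu, forall t, D t -> r v t = r u t + r (v - u) t}.
Proof. by have := rD u (v - u); rewrite addrC subrK. Qed.

Let phi_expansion u (e : R) : 0 < e -> exists2 K, 0 <= K & forall v,
  `|phi (v + u) - (phi u + dphi u v)| <= (e + K * (c * `|v|)) * (c * `|v|).
Proof.
move=> e0.
(* The modulus is requested for [e ^+ 2], so that [H] has L^2 norm at most [e]. *)
have [K [H [K0 sH He osc]]] := nemytskii_modulus mD muD C0 g_meas g_cont g_growth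
  (r_meas u) (r_sq u) (exprn_gt0 2 e0).
exists K => // v.
have szD : sqint mu D (fun t => znorm (r u t + r v t)).
  apply: (sqint_le mD _ (sqintD mD (r_sq u) (r_sq v))).
    exact/measurable_znorm/zmeasD.
  by move=> t _; rewrite ger0_norm ?znorm_ge0// znormD.
have iFD := integrable_functional (zmeasD (r_meas u) (r_meas v)) szD.
have iFu := integrable_functional (r_meas u) (r_sq u).
have idv := integrable_derivative u v.
have -> : phi (v + u) = \int[mu]_(t in D) F t (r u t + r v t).
  apply: (ae_eq_Rintegral (mu := mu)) => //.
  - exact: (measurable_caratheodory mD F_meas F_cont).
  - exact: integrable_measurableR iFD.
  by rewrite addrC; apply: filterS (rD u v) => t rt Dt; rewrite rt.
have -> : \int[mu]_(t in D) F t (r u t + r v t) - (phi u + dphi u v) =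
    \int[mu]_(t in D) (F t (r u t + r v t) - F t (r u t) - zdot (g t (r u t)) (r v t)).
  by rewrite opprD addrA -RintegralB// -RintegralB//; exact: integrableBR.
have iR := integrableBR mD (integrableBR mD iFD iFu) idv.
apply: le_trans (le_normr_Rintegral mD iR) _.
apply: le_trans (remainder_le v v K0 (ltW e0) sH He).
apply: le_Rintegral => //; [exact: integrable_norm iR|exact: remainder_integrable|].
(* For fixed [t], the mean value inequality is used with [G] the gradient at [r u t] and constant
   [H t + K * znorm (r v t)]. *)
move=> t Dt; apply: F_mvt => // w wv; apply: le_trans (osc t w Dt) _.
by rewrite lerD2l ler_wpM2l.
Qed.

(** The bound is linear in the norm of [v] with a factor that does not depend on its direction,
    hence controls the dual norm of the difference. *)
Let dphi_modulus u (e : R) : 0 < e -> exists2 K, 0 <= K & forall w v,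
  `|dphi w v - dphi u v| <= (e + K * (c * `|w - u|)) * (c * `|v|).
Proof.
move=> e0.
have [K [H [K0 sH He osc]]] := nemytskii_modulus mD muD C0 g_meas g_cont g_growth
  (r_meas u) (r_sq u) (exprn_gt0 2 e0).
exists K => // w v.
pose h t := zdot (g t (r u t + r (w - u) t) - g t (r u t)) (r v t).
have mh : measurable_fun D h.
  apply: measurable_zdot => //; apply: zmeasB => //.
  exact: (zmeas_caratheodory mD g_meas g_cont (zmeasD (r_meas u) (r_meas (w - u)))).
have hle t : D t -> `|h t| <= (H t + K * znorm (r (w - u) t)) * znorm (r v t).
  move=> Dt; apply: le_trans (zdot_le _ _) _.
  by rewrite ler_wpM2r ?znorm_ge0// osc.
have iR := remainder_integrable K v (w - u) sH.
have ih := dominated_integrableR mD mh iR hle.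
have -> : dphi w v - dphi u v = \int[mu]_(t in D) h t.
  rewrite -RintegralB//; try exact: integrable_derivative.
  apply: (ae_eq_Rintegral (mu := mu)) => //.
    by apply: measurable_funB; exact: integrable_measurableR (integrable_derivative _ _).
  apply: filterS (rB u w) => t rt Dt; rewrite /h -rt// /zdot.
  have edotB m k (A1 A2 A3 : 'M[R]_(m, k)) : edot (A1 - A2) A3 = edot A1 A3 - edot A2 A3.
    by rewrite edotDl -scaleN1r edotZl mulN1r.
  by rewrite !edotB; ring.
apply: le_trans (le_normr_Rintegral mD ih) _.
apply: le_trans (remainder_le v (w - u) K0 (ltW e0) sH He).
by apply: le_Rintegral => //; exact: integrable_norm ih.
Qed.

Let phi_diff u : differentiable phi u /\ 'd phi u = dphi u :> (V -> R).
Proof.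
pose df : {linear V -> R} := HB.pack (dphi u)
  (GRing.isLinear.Build R V R _ (dphi u) (@dphi_linear u)).
have cdf : continuous df.
  move=> v; have [M M0 dM] := dphi_bounded u.
  apply/cvgrPdist_le => e e0.
  have M1 : 0 < M + 1 by rewrite ltr_wpDl.
  near=> w.
  rewrite -linearB; apply: le_trans (dM _) _.
  apply: (@le_trans _ _ ((M + 1) * `|v - w|)); first by rewrite ler_wpM2r// lerDl.
  rewrite mulrC -ler_pdivlMr//; near: w; apply: cvgr_dist_le; first exact: cvg_id.
  by rewrite divr_gt0.
have edf : phi \o shift u = cst (phi u) + df +o_ (0 : V) id.
  apply/eqaddoP => e e0.
  have [e1 e10 small] := remainder_small c0 e0.
  have [K K0 expand] := phi_expansion u e10.
  have [de de0 {}small] := small K K0.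
  near=> v.
  have vde : 0 <= `|v| <= de by rewrite normr_ge0/=; near: v; exact: nbhs0_le.
  exact: le_trans (expand v) (small _ _ vde (normr_ge0 v)).
have dE : 'd phi u = dphi u :> (V -> R) by exact: (diff_unique cdf edf).
split => //; apply/diff_locallyP; rewrite dE; split; first exact: cdf.
exact: edf.
Unshelve. all: by end_near. Qed.

Theorem functional_continuously_differentiable :
  continuously_differentiable phi /\
  forall u v, 'd phi u v = \int[mu]_(t in D) zdot (g t (r u t)) (r v t).
Proof.
split; last by move=> u v; have [_ ->] := phi_diff u.
split => [u|u]; first by have [] := phi_diff u.
apply/cvgr0Pnorm_le => e e0.
have [e1 e10 small] := remainder_small c0 e0.
have [K K0 dK] := dphi_modulus u e10.
have [de de0 {}small] := small K K0.
near=> w.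
have wde : 0 <= `|w - u| <= de.
  rewrite normr_ge0/= distrC; near: w; apply: cvgr_dist_le => //; exact: cvg_id.
have lE v : 'd phi w v - 'd phi u v = dphi w v - dphi u v.
  by have [_ ->] := phi_diff w; have [_ ->] := phi_diff u.
have le v : `|v| <= 1 -> `|'d phi w v - 'd phi u v| <= e.
  move=> v1; rewrite lE; apply: le_trans (dK w v) _.
  by apply: le_trans (small _ _ wde (normr_ge0 v)) _; rewrite ler_piMr// ltW.
have ub : ubound [set `|'d phi w v - 'd phi u v| | v in [set v : V | `|v| <= 1]] e.
  by move=> _ [v /= v1 <-]; exact: le.
(* Nonempty (through [v = 0]) and bounded above, the set has a genuine supremum rather than the
   default value of [sup]. *)
have in0 : [set `|'d phi w v - 'd phi u v| | v in [set v : V | `|v| <= 1]]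
    `|'d phi w 0 - 'd phi u 0|.
  by exists 0 => //=; rewrite normr0.
rewrite ger0_norm; first by apply: ge_sup => //; eexists; exact: in0.
by apply: le_trans (ub_le_sup _ in0) => //; exists e.
Unshelve. all: by end_near. Qed.

End integral_functional.

(** * The action functional *)

(** The derivative at 0 is only one-sided, whereas the mean value theorem asks for two-sided ones.
    The difference quotient at 0, eventually below [a' 0 + 1], controls [a] on a short interval; the
    theorem is then applied from an interior point [d] of it. *)
Lemma C1_halfline_linear_growth (R : realType) (a a' : R -> R) (M : R) :
  C1_halfline a a' -> (forall s, 0 <= s -> a' s <= M) ->
  exists2 A, 0 <= A & forall s, 0 <= s -> a s <= A + `|M| * s.
Proof.
move=> [da _] a'M.
have [e e0 ea] : exists2 e : R, 0 < e &
    forall h, 0 < h -> h < e -> a h <= `|a 0| + `|a' 0 + 1| * h.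
  have /cvgr_le /(_ (a' 0 + 1)) := da 0 (lexx 0).
  rewrite ltrDl ltr01 => /(_ isT)/nbhs_ballP[e /= e0 eP]; exists e => // h h0 he.
  have := eP h; rewrite /ball/= sub0r normrN gtr0_norm// gt_eqF// add0r.
  move=> /(_ he isT (ltW h0)); rewrite mulrC ler_pdivrMr// => ah.
  have := ler_norm (a 0); have := ler_wpM2r (ltW h0) (ler_norm (a' 0 + 1)); lra.
have da' (s : R) : 0 < s -> is_derive s 1 a (a' s).
  move=> s0; have H : h^-1 *: ((a \o shift s) (h *: (1 : R)) - a s) @[h --> 0^'] --> a' s.
    move=> U /(da s (ltW s0)) hU.
    have sh : \forall h \near (0 : R)^', 0 <= s + h.
      near=> h; rewrite -lerBlDl sub0r lerNl.
      apply: le_trans (ler_norm _) _; rewrite normrN; near: h; exact: dnbhs0_le.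
    have {}hU : \forall h \near (0 : R)^', 0 <= s + h -> U (h^-1 * (a (s + h) - a s)).
      exact: hU.
    suff : \forall h \near (0 : R)^', U (h^-1 *: ((a \o shift s) (h *: (1 : R)) - a s)).
      exact.
    near=> h.
    suff : U (h^-1 * (a (s + h) - a s)) by rewrite /= [h *: 1]mulr1 (addrC h).
    have : 0 <= s + h by near: h; exact: sh.
    near: h; exact: hU.
  by split; [apply/cvg_ex; exists (a' s)|exact: cvg_lim H].
pose d := e / 2; have d0 : 0 < d by rewrite divr_gt0.
have de : d < e by rewrite ltr_pdivrMr// ltr_pMr// ltr1n.
(* Bounds [a] on the whole interval from 0 to [e], in particular at the starting point [d]. *)
exists (`|a 0| + `|a' 0 + 1| * e); first by rewrite addr_ge0// mulr_ge0// ltW.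
move=> s s0.
have [->|sN0] := eqVneq s 0.
  rewrite mulr0 addr0; apply: le_trans (ler_norm _) _.
  by rewrite lerDl mulr_ge0// ltW.
have {s0 sN0} s0 : 0 < s by rewrite lt_neqAle eq_sym sN0.
have [se|es] := ltP s e.
  have := ler_wpM2l (normr_ge0 (a' 0 + 1)) (ltW se).
  have := mulr_ge0 (normr_ge0 M) (ltW s0); have := ea s s0 se; lra.
have ds : d <= s by apply: le_trans es; exact: ltW.
have [x| |c] := @MVT_segment R a a' d s ds.
- by rewrite in_itv/= => /andP[dx _]; apply: da'; apply: lt_trans dx.
- apply: derivable_within_continuous => x; rewrite in_itv/= => /andP[dx _].
  by apply: ex_derive; apply: da'; apply: lt_le_trans dx.
rewrite in_itv/= => /andP[dc _] E.
have c0 : 0 <= c by apply: le_trans dc; exact: ltW.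
have sd : 0 <= s - d by rewrite subr_ge0.
have := ler_wpM2r sd (le_trans (a'M c c0) (ler_norm M)).
have := ler_wpM2l (normr_ge0 M) (ltW d0).
have := ler_wpM2l (normr_ge0 (a' 0 + 1)) (ltW de).
have := ea d d0 de; lra.
Unshelve. all: by end_near. Qed.

(** A pointwise limit of difference quotients with steps 1/(N+1), each measurable in [t]. *)
Lemma measurable_partial (R : realType) (d : measure_display)
    (T : measurableType d) (D : set T) m k (f : T -> 'M[R]_(m, k) -> R) A v :
  (forall B, measurable_fun D (f^~ B)) ->
  (forall t, D t -> derivable (f t) A v) ->
  measurable_fun D (fun t => 'D_v (f t) A).
Proof.
move=> mf df.
apply: (@measurable_fun_cvg _ _ _ _
  (fun N t => N.+1%:R * (f t (N.+1%:R^-1 *: v + A) - f t A))) => [N|t Dt].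
  by apply: measurable_funM; [exact: measurable_cst|exact: measurable_funB].
have u0 : N.+1%:R^-1 @[N --> \oo] --> (0 : R)^'.
  move=> U [e /= e0 eU].
  have he : \forall N \near \oo, ball (0 : R) e N.+1%:R^-1.
    exact: (@cvg_harmonic R _ (nbhsx_ballx (0 : R) e e0)).
  suff : \forall N \near \oo, U N.+1%:R^-1 by [].
  near=> N.
  have NU : N.+1%:R^-1 != 0 :> R -> U N.+1%:R^-1.
    by apply: (eU N.+1%:R^-1); near: N; exact: he.
  by apply: NU; rewrite invr_neq0 ?pnatr_eq0.
have := cvg_comp _ _ u0 (df t Dt).
by apply: cvg_trans; apply: near_eq_cvg; apply: nearW => N /=; rewrite invrK.
Unshelve. all: by end_near. Qed.

(** * Sobolev classes as square-integrable functions into the phase space *)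

Section Sobolev_representative.
Variables (R : realType) (p n : nat) (T : 'rV[R]_p).

Local Notation D := (box T : set (lebesgue_rV R p)).
Local Notation Z := ('rV[R]_n * 'M[R]_(n, p))%type.

Definition W_rep (u : W n T) (t : lebesgue_rV R p) : Z := (W_fun u t, W_grad u t).

(** The number of entries of u plus that of du/dt, the constants given by [l1_le_enorm]. *)
Definition W_rep_const : R := (1 * n)%:R + (n * p)%:R.

Local Notation c := W_rep_const.

Lemma W_rep_const_ge0 : 0 <= c.
Proof. by rewrite addr_ge0. Qed.

Let znorm_sq_le (z : Z) : znorm z ^+ 2 <= c ^+ 2 * (edot z.1 z.1 + edot z.2 z.2).
Proof.
have h1 := l1_le_enorm z.1; have h2 := l1_le_enorm z.2.
rewrite -(sqr_sqrtr (edot_ge0 z.1)) -(sqr_sqrtr (edot_ge0 z.2)) -!/(enorm _).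
move: h1 h2 (enorm_ge0 z.1) (enorm_ge0 z.2); rewrite /W_rep_const.
set x := enorm z.1; set y := enorm z.2.
have := ler0n R (1 * n); have := ler0n R (n * p).
set al := (1 * n)%:R; set be := (n * p)%:R => be0 al0 h1 h2 x0 y0.
apply: (@le_trans _ _ ((al * x + be * y) ^+ 2)).
  rewrite lerXn2r ?nnegrE ?addr_ge0 ?mulr_ge0 ?l1_ge0//.
  exact: lerD.
(* The gap in the inequality (al x + be y)^2 <= (al + be)^2 (x^2 + y^2), as a sum of nonnegative
   terms. *)
rewrite -subr_ge0 (_ : _ - _ = (al * y - be * x) ^+ 2 +
  2 * (al * be) * (x ^+ 2 + y ^+ 2)); last by ring.
by rewrite addr_ge0 ?sqr_ge0// !mulr_ge0 ?addr_ge0 ?sqr_ge0.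
Qed.

Lemma W_rep_meas u : zmeas D (W_rep u).
Proof.
by have [L1 L2' _] := preW_ipP (repr u); split => i j;
  [case: (L1 i j)|case: (L2' i j)].
Qed.

Lemma W_rep_sqint u : sqint lebesgue D (fun t => znorm (W_rep u t)).
Proof.
have mz := measurable_znorm (W_rep_meas u).
split => //.
apply: (dominated_integrableR (measurable_box T) _
  (integrableZR (measurable_box T) (c ^+ 2) (preW_ip_integrable (repr u) (repr u)))).
  exact: measurable_funX.
by move=> t _; rewrite ger0_norm ?sqr_ge0//; exact: znorm_sq_le.
Qed.

Lemma W_rep_norm u :
  \int[lebesgue]_(t in D) (znorm (W_rep u t) ^+ 2) <= (c * `|u|) ^+ 2.
Proof.
have -> : (c * `|u|) ^+ 2 = c ^+ 2 * preW_ip (repr u) (repr u).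
  by rewrite exprMn; congr (_ * _); rewrite sqr_sqrtr// preW_ip_ge0.
have mD := measurable_box T.
rewrite -RintegralZl//; last exact: preW_ip_integrable.
apply: le_Rintegral => //; first by case: (W_rep_sqint u).
exact: integrableZR (preW_ip_integrable _ _).
Qed.

(** The representative chosen for the class of a combination agrees with the combination of the
    chosen representatives off a null set. *)
Lemma W_rep_linear (a : R) u v : {ae @lebesgue R p, forall t, D t ->
  W_rep (a *: u + v) t = a *: W_rep u t + W_rep v t}.
Proof.
have -> : a *: u + v = \pi_(W n T)%qT (a *: repr u + repr v).
  by rewrite -pi_addW reprK.
have := W_repr_ae (a *: repr u + repr v).
apply: (filterS (F := almost_everywhere (@lebesgue R p))) => t rt Dt.
have [h1 h2] := rt Dt.
by rewrite /W_rep h1 h2.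
Qed.

End Sobolev_representative.

(** * Measurability and continuity of the gradient of the Lagrangian *)

Section Lagrangian_gradient.
Variables (R : realType) (p n : nat) (T : 'rV[R]_p).
Variable L : 'rV[R]_p -> 'rV[R]_n -> 'M[R]_(n, p) -> R.

Local Notation D := (box T : set (lebesgue_rV R p)).
Local Notation Z := ('rV[R]_n * 'M[R]_(n, p))%type.

Hypothesis L_measurable : forall x y, measurable_fun D (fun t => L t x y).
Hypothesis L_partials : forall t, box T t -> continuous_partials L t.

Lemma zmeas_zgrad (z : Z) : zmeas D (fun t : lebesgue_rV R p => zgrad (L t) z).
Proof.
split => i j.
  rewrite (_ : (fun _ => _) = fun t => 'D_(delta_mx i j) (fun x => L t x z.2) z.1).
    apply: (measurable_partial (f := fun t : lebesgue_rV R p => fun x => L t x z.2)).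
      by move=> x; exact: L_measurable.
    by move=> t Dt; rewrite (ord1 i); have [dx _ _ _] := L_partials Dt; exact: dx.
  by apply/funext => t; rewrite mxE.
rewrite (_ : (fun _ => _) = fun t => 'D_(delta_mx i j) (fun y => L t z.1 y) z.2).
  apply: (measurable_partial (f := fun t : lebesgue_rV R p => fun y => L t z.1 y)).
    by move=> y; exact: L_measurable.
  by move=> t Dt; have [_ dy _ _] := L_partials Dt; exact: dy.
by apply/funext => t; rewrite mxE.
Qed.

Lemma zgrad_continuous t : box T t -> continuous (zgrad (L t) : Z -> Z).
Proof.
move=> Dt z; have [_ _ cx cy] := L_partials Dt.
exact: (cvg_pair (cx z) (cy z)).
Qed.

End Lagrangian_gradient.

Theorem theorem3 (R : realType) (p n : nat) (p_gt0 : (0 < p)%N) (n_gt0 : (0 < n)%N)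
  (T : 'rV[R]_p) (T_gt0 : forall al, 0 < T 0 al)
  (L : 'rV[R]_p -> 'rV[R]_n -> 'M[R]_(n, p) -> R)
  (L_measurable : forall (x : 'rV[R]_n) (y : 'M[R]_(n, p)),
     measurable_fun (box T : set (lebesgue_rV R p)) (fun t => L t x y))
  (L_partials : forall t, box T t -> continuous_partials L t)
  (a a' : R -> R)
  (a_ge0 : forall s, 0 <= s -> 0 <= a s)
  (a_C1 : C1_halfline a a')
  (a'_bounded_above : exists M : R, forall s, 0 <= s -> a' s <= M)
  (b : 'rV[R]_p -> R)
  (b_ge0 : forall t, box T t -> 0 <= b t)
  (b_continuous : {within box T, continuous b})
  (L_bound : forall t x y, box T t ->
     `|L t x y| <= a (enorm x + enorm y ^+ 2) * b t)
  (Lx_bound : forall t x y, box T t -> enorm (grad_x L t x y) <= a (enorm x) * b t)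
  (Ly_bound : forall t x y, box T t -> enorm (grad_y L t x y) <= a (enorm y) * b t) :
  [/\ forall u : W n T, lebesgue.-integrable (box T)
        (fun t => (L t (W_fun u t) (W_grad u t))%:E),
      continuously_differentiable (action L : W n T -> R) &
      forall u v : W n T,
        let dL := fun t =>
          edot (grad_x L t (W_fun u t) (W_grad u t)) (W_fun v t) +
          edot (grad_y L t (W_fun u t) (W_grad u t)) (W_grad v t) in
        lebesgue.-integrable (box T) (fun t => (dL t)%:E) /\
        'd (action L : W n T -> R) u v = \int[lebesgue]_(t in box T) dL t].
Proof.
have mD := measurable_box T.
have muD : (lebesgue (box T) < +oo)%E := lebesgue_box_lty T.
have [M a'M] := a'_bounded_above.
have [A A0 aA] := C1_halfline_linear_growth a_C1 a'M.
have [B B0 bB] : exists2 B, 0 <= B & forall t, box T t -> b t <= B.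
  have /compact_bounded[B' [_ B'P]] : compact (b @` box T).
    by apply: continuous_compact => //; exact: compact_box.
  exists (`|B'| + 1) => [|t Dt]; first by rewrite addr_ge0.
  apply: le_trans (ler_norm _) _; apply: (B'P (`|B'| + 1)); last by exists t.
  by apply: le_lt_trans (ler_norm _) _; rewrite ltrDl.
pose S := A + `|M|; have S0 : 0 <= S by rewrite addr_ge0.
have ab s t : 0 <= s -> box T t -> a s * b t <= S * B * (1 + s).
  move=> s0 Dt; rewrite mulrAC ler_pM ?a_ge0 ?b_ge0 ?bB//.
  apply: le_trans (aA s s0) _; rewrite /S.
  by have := mulr_ge0 A0 s0; have := normr_ge0 M; lra.
pose gr (t : lebesgue_rV R p) := zgrad (L t).
pose F (t : lebesgue_rV R p) (z : 'rV[R]_n * 'M[R]_(n, p)) := L t z.1 z.2.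
pose C := W_rep_const R p n * (S * B).
have C0 : 0 <= C by rewrite mulr_ge0 ?W_rep_const_ge0 ?mulr_ge0.
have gr_growth t z : box T t -> znorm (gr t z) <= C * (1 + znorm z).
  move=> Dt; rewrite /znorm /C /W_rep_const -mulrA mulrDl.
  (* [a] need not be monotone, so it is replaced by its affine bound before the norm of one
     component is enlarged to that of [z]. *)
  have mono m k (x : 'M[R]_(m, k)) : enorm x <= znorm z ->
      a (enorm x) * b t <= S * B * (1 + znorm z).
    move=> xz; apply: le_trans (ab _ _ (enorm_ge0 _) Dt) _.
    by rewrite ler_wpM2l ?mulr_ge0// lerD2l.
  apply: lerD; apply: le_trans (l1_le_enorm _) _; rewrite ler_wpM2l//.
    apply: le_trans (Lx_bound t z.1 z.2 Dt) _; apply: mono.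
    by apply: le_trans (enorm_le_l1 _) _; rewrite lerDl l1_ge0.
  apply: le_trans (Ly_bound t z.1 z.2 Dt) _; apply: mono.
  by apply: le_trans (enorm_le_l1 _) _; rewrite lerDr l1_ge0.
have F_meas z : measurable_fun (box T : set (lebesgue_rV R p)) (F^~ z).
  exact: L_measurable.
have F_cont t : box T t -> continuous (F t).
  move=> Dt; have [dx dy _ _] := L_partials t Dt.
  by apply: (zgrad_growth_continuous dx dy C0) => z; exact: gr_growth.
(* The factor 3 comes from |z| <= 1 + |z|^2, itself a consequence of (|z| - 1)^2 >= 0. *)
have F_growth t z : box T t -> `|F t z| <= 3 * (S * B) * (1 + znorm z ^+ 2).
  move=> Dt; apply: le_trans (L_bound t z.1 z.2 Dt) _.
  have x0 := enorm_ge0 z.1; have y0 := enorm_ge0 z.2.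
  apply: le_trans (ab _ _ _ Dt) _; first by rewrite addr_ge0 ?sqr_ge0.
  rewrite [leRHS](_ : _ = S * B * (3 * (1 + znorm z ^+ 2))); last by ring.
  rewrite ler_wpM2l ?mulr_ge0//.
  have xz : enorm z.1 <= znorm z.
    by apply: le_trans (enorm_le_l1 _) _; rewrite lerDl l1_ge0.
  have yz : enorm z.2 ^+ 2 <= znorm z ^+ 2.
    rewrite lerXn2r ?nnegrE ?znorm_ge0//.
    by apply: le_trans (enorm_le_l1 _) _; rewrite lerDr l1_ge0.
  by have := sqr_ge0 (znorm z - 1); rewrite sqrrB mulr1 expr1n -mulr_natr; lra.
have F_mvt t z v G (k : R) : box T t ->
    (forall w, znorm w <= znorm v -> znorm (gr t (z + w) - G) <= k) ->
    `|F t (z + v) - F t z - zdot G v| <= k * znorm v.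
  by move=> Dt; have [dx dy _ _] := L_partials t Dt; exact: zgrad_mvt.
have gr_meas := zmeas_zgrad L_measurable L_partials.
have gr_cont := zgrad_continuous L_partials.
have [cd dE] := functional_continuously_differentiable mD muD F_meas F_cont F_growth
  F_mvt C0 gr_meas gr_cont gr_growth (@W_rep_meas R p n T) (W_rep_const_ge0 R p n)
  (@W_rep_sqint R p n T) (@W_rep_norm R p n T) (@W_rep_linear R p n T).
split => [u| |u v dL].
- exact: (integrable_functional mD muD F_meas F_cont F_growth (W_rep_meas u)
    (W_rep_sqint u)).
- exact: cd.
split; last exact: dE.
exact: (integrable_derivative mD muD gr_meas gr_cont gr_growth (@W_rep_meas R p n T)
  (@W_rep_sqint R p n T)).
Qed.
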